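(* Let $\alpha>0$ and, for each positive integer $x$, let $\ell(x)$ be the local time at $x$ of the one-dimensional random interlacements at level $\alpha$. Then, as $x\to\infty$, $$\frac{\ell(x)-\alpha x^2}{x\sqrt{\alpha(4x-1)}}$$ converges in law to a standard normal random variable $Z\sim\mathcal{N}(0,1)$.
   Context: One-dimensional random interlacements at level $\alpha$ is a Poisson process of doubly infinite trajectories of the simple random walk conditioned on never hitting $0$ (on the positive integers this walk has transition probabilities $P(y,y+1)=\frac{y+1}{2y}$, $P(y,y-1)=\frac{y-1}{2y}$, $y\ge1$). The local time $\ell(x)$ at a site $x$ is the total number of visits to $x$ by all trajectories at level $\alpha$. For a positive integer $x$, the number $N_{\{x\}}$ of trajectories hitting $x$ is Poisson with parameter $\alpha x/2$, and each such trajectory visits $x$ a geometric number of times with success probability $\frac1{2x}$; thus $$\ell(x)=\sum_{k=1}^{N_{\{x\}}}V_k,$$ where $N_{\{x\}}\sim\mathrm{Poisson}(\alpha x/2)$ and $V_1,V_2,\dots$ are i.i.d., independent of $N_{\{x\}}$, with $\mathbb{P}[V_k=j]=\frac{1}{2x}\left(1-\frac{1}{2x}\right)^{j-1}$ for $j\ge 1$. *)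

(* Defs.v *)
From HB Require Import structures.
From mathcomp Require Import all_boot all_order all_algebra.
From mathcomp Require Import all_classical all_reals all_analysis.

Set Implicit Arguments.
Unset Strict Implicit.
Unset Printing Implicit Defensive.
Import Order.TTheory GRing.Theory Num.Theory.
Import numFieldNormedType.Exports.
Local Open Scope classical_set_scope.
Local Open Scope ring_scope.

(** * Trajectories *)

(* Measurable types are pointed in the library, and int is not declared so. *)
HB.instance Definition _ := isPointed.Build int 0.

Definition path_cylinders : set (set (int -> int)) :=
  [set C | exists k y, C = [set w | w k = y]].

(* Doubly infinite sequences, with the product sigma-algebra. *)
Definition trajectory := g_sigma_algebraType path_cylinders.

Definition shift_trajectory (k : int) (w : int -> int) : int -> int :=
  fun n => w (n + k).

Definition shift_invariant (A : set (int -> int)) :=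
  forall k w, A (shift_trajectory k w) <-> A w.

(* Trajectories modulo time shift.  Instead of taking the quotient, we keep a
   representative and restrict the measurable sets to the shift-invariant ones;
   these are exactly the preimages of the measurable subsets of the quotient. *)
Definition trajectory_mod_shift : Type := int -> int.

HB.instance Definition _ :=
  Pointed.copy trajectory_mod_shift (int -> int).

Definition mod_shift_measurable : set (set trajectory_mod_shift) :=
  [set A | measurable (A : set trajectory) /\ shift_invariant A].

Lemma mod_shift_measurable0 : mod_shift_measurable set0.
Proof. by split; [exact: measurable0|]. Qed.

Lemma mod_shift_measurableC A :
  mod_shift_measurable A -> mod_shift_measurable (~` A).
Proof.
move=> [mA iA]; split; first exact: (@measurableC _ trajectory).
by move=> k w; split=> nA Aw; apply: nA; [exact/(iA k)|exact: (iA k w).1].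
Qed.

Lemma mod_shift_measurable_bigcup (F : (set trajectory_mod_shift)^nat) :
  (forall i, mod_shift_measurable (F i)) ->
  mod_shift_measurable (\bigcup_i F i).
Proof.
move=> mF; split.
  by apply: (@bigcupT_measurable _ trajectory) => i; have [] := mF i.
by move=> k w; split=> -[i _ Fw]; exists i => //; have [_ iF] := mF i;
  have [iF1 iF2] := iF k w; first [exact: iF1|exact: iF2].
Qed.

Fact mod_shift_display : measure_display. Proof. exact: default_measure_display. Qed.

HB.instance Definition _ :=
  @isMeasurable.Build mod_shift_display trajectory_mod_shift
    mod_shift_measurable mod_shift_measurable0 mod_shift_measurableC
    mod_shift_measurable_bigcup.

(** * Simple random walk conditioned on never hitting 0 *)

(* Doob transform of the simple random walk on the integers by its potential
   kernel |.|, harmonic outside 0; for y > 0 this is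
   (y + 1) / (2 y) at z = y + 1 and (y - 1) / (2 y) at z = y - 1. *)
Definition conditioned_step {R : realType} (y z : int) : R :=
  if `|z - y|%N == 1%N then (`|z|%N)%:R / (2 * (`|y|%N)%:R) else 0.

(* [Q y] is the law of the two-sided walk equal to y at time 0: the future
   and the past are two independent conditioned walks started at y. *)
Definition two_sided_conditioned_walk {R : realType}
    (Q : int -> probability trajectory R) :=
  forall (y : int) (n : nat) (v : int -> int), y != 0 ->
    Q y [set w : trajectory | forall k : int, (`|k| <= n)%N -> w k = v k] =
    ((v 0 == y)%:R
      * \prod_(0 <= i < n) conditioned_step (v i%:Z) (v i.+1%:Z)
      * \prod_(0 <= i < n) conditioned_step (v (- i%:Z)) (v (- i.+1%:Z)))%:E.

(** * Intensity of the interlacements *)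

Definition hits (K : set int) : set (int -> int) :=
  [set w | exists n : int, K (w n)].

(* Trajectories outside K at all negative times. *)
Definition avoids_before0 (K : set int) : set (int -> int) :=
  [set w | forall n : int, n < 0 -> ~ K (w n)].

(* Trajectories hitting K, parametrized so that the first visit to K is at time
   0.  The conditioned walk is reversible with respect to the weights y ^ 2, and
   y ^ 2 * Q y (avoids_before0 K) is the equilibrium measure of K at y; the
   past is thus the conditioned walk further conditioned not to return to K. *)
Definition entrance_measure {R : realType} (Q : int -> probability trajectory R)
    (K : set int) (A : set (int -> int)) : \bar R :=
  (\sum_(y \in K) ((`|y|%N ^ 2)%N%:R)%:E * Q y (A `&` avoids_before0 K))%E.

Definition interlacement_intensity {R : realType}
    (Q : int -> probability trajectory R)
    (nu : {measure set trajectory_mod_shift -> \bar R}) :=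
  forall (K : set int) (A : set trajectory_mod_shift),
    finite_set K -> measurable A ->
    nu (A `&` hits K) = entrance_measure Q K A.

(** * Poisson point processes *)

(* The points are enumerated as X 0, X 1, and so on, so the total mass of the
   intensity m has to be infinite.  The second argument of [poisson_prob] is
   unused by the library; [poisson_pmf] would not do, as it is constantly 1 at
   rate 0. *)
Definition poisson_process {R : realType} d (Omega : measurableType d)
    (P : probability Omega R) d' (T : measurableType d')
    (m : set T -> \bar R) (X : nat -> Omega -> T) :=
  (forall i, measurable_fun setT (X i)) /\
  forall (n : nat) (A : 'I_n -> set T) (k : 'I_n -> nat),
    (forall j, measurable (A j)) -> trivIset setT A ->
    (forall j, (m (A j) < +oo)%E) ->
    P [set o | forall j,
        counting [set i | A j (X i o)] = ((k j)%:R)%:E :> \bar R] =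
    (\prod_(j < n) poisson_prob (fine (m (A j))) 0%N [set k j])%E.

(** * One-dimensional random interlacements *)

(* The law is determined by alpha: Q is unique on the nonzero integers by its
   cylinder probabilities, and nu is unique since the sets [hits K], for K
   finite, exhaust the space of trajectories. *)
Definition random_interlacements {R : realType} d (Omega : measurableType d)
    (P : probability Omega R) (alpha : R)
    (W : nat -> Omega -> trajectory_mod_shift) :=
  exists (Q : int -> probability trajectory R)
         (nu : {measure set trajectory_mod_shift -> \bar R}),
    [/\ two_sided_conditioned_walk Q,
        interlacement_intensity Q nu
      & poisson_process P (fun A => alpha%:E * nu A)%E W].

Definition visits {R : realType} (x : int) (w : int -> int) : \bar R :=
  counting [set n : int | w n = x].

Definition local_time {R : realType} d (Omega : measurableType d)
    (W : nat -> Omega -> trajectory_mod_shift) (x : int) (o : Omega) : \bar R :=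
  (\sum_(i <oo) visits x (W i o))%E.

(** * Convergence in law *)

(* The limit mu is a law on R, as only the law of the limit variable matters. *)
Definition cvg_in_law {R : realType} d (Omega : measurableType d)
    (P : probability Omega R) (X : nat -> Omega -> R)
    (mu : probability (measurableTypeR R) R) :=
  (forall n, measurable_fun setT (X n)) /\
  forall t : R, {for t, continuous (fun s : R => mu `]-oo, s]%classic)} ->
    P [set o | X n o <= t] @[n --> \oo] --> mu `]-oo, t]%classic.

(* Main.v *)
(* The law q of the local time at x is compound Poisson with geometric jumps, so
   its generating function Q solves (1 - (1 - p) X)^2 Q' = p^2 mu Q with
   p = 1/(2x) and mu = alpha x^2.  This three-term recursion on q, summed by
   parts against f of the standardized local time S, shows E[S f(S) - f'(S)] -> 0
   as soon as f, w f, f', w f' are bounded and f' is Lipschitz.  Stein's equation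
   f' - w f = g - E g(Z) has such a solution when g is a logistic function:
   if k' = w k + u with u bounded by U and exp(- w^2/2) k(w) -> 0 at infinity,
   then |w k| <= U, and this applies to both k = f and k = f'.  Steep logistic
   functions approximate the indicators of half-lines.

   The jump law comes from the conditioned walk: P_y(fewer than k returns to x),
   multiplied by y, is harmonic off x, and boundedness fixes its slope. *)

Require Import Defs.
From HB Require Import structures.
From mathcomp Require Import all_boot all_order all_algebra.
From mathcomp Require Import all_classical all_reals all_analysis.
From mathcomp Require Import measurable_realfun ring lra.

Import Order.TTheory GRing.Theory Num.Theory.
Import numFieldNormedType.Exports.
Local Open Scope classical_set_scope.
Local Open Scope ring_scope.
Set Implicit Arguments.
Unset Strict Implicit.
Unset Printing Implicit Defensive.

(** * Stein's equation *)

(** The limit argument uses finite sums over q only: the summation by parts stops at M, and its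
    boundary terms vanish as M grows because the recursion itself bounds the mean of q by mu. The
    recursion yields S f(S) - f'(S) only up to multiples of S f(S) and S f'(S), which is why w f'
    has to be bounded, and not just f'. The error that remains is of order 1/(p sigma), that is
    x^(-1/2).

    The summands of the compound sum are never constructed. Trajectories are sorted by their exact
    number of visits to x. These classes are disjoint, so their counts are independent Poisson
    variables, of rate alpha x^2 p^2 (1 - p)^j for j + 1 visits, and the local time is the sum of j
    + 1 times the j-th count. The event that the local time is m involves finitely many classes, so
    its probability is, up to normalization, a coefficient of a product of truncated exponentials,
    whose logarithmic derivative is proportional to 1/(1 - (1 - p) X)^2 up to high powers of X. *)

Lemma stein_growth_pos {R : realType} (k u : R -> R) (U : R) :
  (forall w : R, is_derive w 1 k (w * k w + u w)) -> (forall w, `|u w| <= U) ->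
  expR (- w ^+ 2 / 2) * k w @[w --> +oo] --> (0 : R) ->
  forall w, 0 < w -> w * k w <= U.
Proof.
move=> dk uU k0 w w0.
have U0 : 0 <= U by apply: le_trans (uU 0).
(* [E] is the integrating factor of k' = v k + u. Subtracting U / v makes [F] nondecreasing on the
   positive axis, since F' = E (u + U + U / v^2); as F <= E k, which tends to 0, F is at most 0. *)
pose E (v : R) := expR (- v ^+ 2 / 2).
pose F (v : R) := E v * (k v - U * v^-1).
have dE (v : R) : is_derive v 1 E (- v * E v).
  rewrite /E; apply: is_derive_eq.
  by rewrite /GRing.scale /=; field.
have dF (v : R) : 0 < v -> is_derive v 1 F (E v * (u v + U + U / v ^+ 2)).
  move=> v0.
  have vn0 : v != 0 by rewrite gt_eqF.
  have dI : is_derive v 1 (fun y : R => y^-1) (- v ^- 2 *: 1).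
    exact: (@is_deriveV _ (@id R)).
  rewrite /F; apply: is_derive_eq.
  by rewrite /GRing.scale /=; field.
have dFy y : y \in `]w, +oo[ -> derivable F y 1.
  rewrite in_itv /= andbT => wy.
  by have [] := dF _ (lt_trans w0 wy).
have dFge0 y : y \in `]w, +oo[ -> 0 <= derive1 F y.
  rewrite in_itv /= andbT => wy.
  have y0 := lt_trans w0 wy.
  rewrite derive1E (@derive_val _ _ _ _ _ _ _ (dF _ y0)).
  rewrite mulr_ge0 ?expR_ge0// addr_ge0//; last by rewrite divr_ge0// sqr_ge0.
  by have := uU y; rewrite ler_norml => /andP[? ?]; lra.
have cF : {within `[w, +oo[, continuous F}.
  apply: continuous_in_subspaceT => y; rewrite inE /= in_itv /= andbT => wy.
  have y0 := lt_le_trans w0 wy.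
  apply: differentiable_continuous; apply/derivable1_diffP.
  by have [] := dF _ y0.
have Fmono v : w <= v -> F w <= F v.
  exact: (ger0_derive1_ndecry dFy dFge0 cF (lexx w)).
have : F w <= 0.
  rewrite -(cvg_lim (@Rhausdorff R) k0); apply: limr_ge.
    by apply/cvg_ex; exists 0.
  near=> v.
  have wv : w <= v by near: v; apply: nbhs_pinfty_ge; rewrite num_real.
  apply: (le_trans (Fmono _ wv)); rewrite /F mulrBr lerBlDr lerDl.
  by rewrite mulr_ge0 ?expR_ge0// divr_ge0// (le_trans (ltW w0)).
rewrite /F pmulr_rle0 ?expR_gt0// subr_le0 => kw.
by rewrite mulrC -ler_pdivlMr.
Unshelve. all: by end_near.
Qed.

(** The equation is preserved by (k, u) -> (-k, -u) and by (k(w), u(w)) -> (k(-w), -u(-w)), so the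
    one-sided bound covers both signs of k and both half-lines. *)
Lemma stein_growth {R : realType} (k u : R -> R) (U : R) :
  (forall w : R, is_derive w 1 k (w * k w + u w)) -> (forall w, `|u w| <= U) ->
  expR (- w ^+ 2 / 2) * k w @[w --> +oo] --> (0 : R) ->
  expR (- w ^+ 2 / 2) * k w @[w --> -oo] --> (0 : R) ->
  forall w, `|w * k w| <= U.
Proof.
move=> dk uU kp kn.
have abs_pos (h v : R -> R) : (forall w : R, is_derive w 1 h (w * h w + v w)) ->
  (forall w, `|v w| <= U) -> expR (- w ^+ 2 / 2) * h w @[w --> +oo] --> (0 : R) ->
  forall w, 0 < w -> `|w * h w| <= U.
  move=> dh vU h0 w w0; rewrite ler_norml (@stein_growth_pos _ h v)// andbT.
  rewrite lerNl -mulrN; apply: (@stein_growth_pos _ (fun x => - h x) (fun x => - v x)) => //.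
  - move=> x; have := @is_deriveN _ _ _ h x 1 _ (dh x).
    by rewrite opprD -mulrN.
  - by move=> x; rewrite normrN.
  - under eq_fun do rewrite mulrN.
    by rewrite -oppr0; apply: cvgN.
move=> w; have [w0|w0|->] := ltgtP w 0; last 2 first.
- exact: abs_pos.
- by rewrite mul0r normr0 (le_trans _ (uU 0)).
have -> : w * k w = - (- w * k (- (- w))) by rewrite opprK mulNr opprK.
rewrite normrN; apply: (abs_pos (fun x => k (- x)) (fun x => - u (- x))).
- move=> x; have dNx : is_derive x 1 (-%R : R -> R) (-1).
    by have := @is_deriveN _ _ _ (@id R) x 1 _ _; apply.
  have := @is_derive1_comp _ k -%R x _ _ (dk (- x)) dNx.
  move=> H; apply: (is_derive_eq H); ring.
- by move=> x; rewrite normrN.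
- move/cvgNy_compNP : kn => /=.
  by under eq_fun do rewrite sqrrN.
- by rewrite oppr_gt0.
Qed.

Lemma bounded_of_growth {R : realType} (k : R -> R) (U : R) :
  continuous k -> (forall w, `|w * k w| <= U) ->
  exists2 C, 0 <= C & forall w, `|k w| <= C.
Proof.
move=> ck kU.
have [M [_ hM]] := compact_bounded (continuous_compact
  (continuous_subspaceT ck) (@segment_compact R (-1) 1)).
have U0 : 0 <= U by apply: le_trans (kU 0).
have M1 : M < `|M| + 1 by rewrite ltr_pwDr// ler_norm.
exists (`|M| + 1 + U) => [|w]; first by rewrite !addr_ge0.
have [w1|w1] := lerP `|w| 1.
  apply: ler_wpDr => //; apply: hM M1 _ _; exists w => //=.
  by rewrite in_itv /= -ler_norml.
apply: (@le_trans _ _ U); last by rewrite lerDr addr_ge0.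
apply: le_trans (kU w); rewrite normrM ler_peMl//; exact: ltW.
Qed.

(** * The standard normal distribution function and density *)

Section normal_cdf.
Context {R : realType}.
Local Notation mu := (@lebesgue_measure R).

(** The identity as a random variable under the normal law: its distribution function is
    [normal_cdf], so the general limits at -oo and +oo apply. *)
Let idTR : measurableTypeR R -> R := idfun.

#[local] HB.instance Definition _ :=
  @isMeasurableFun.Build _ _ _ _ idTR (@measurable_id _ _ setT).

Definition normal_cdf (w : R) : R := fine (normal_prob (0 : R) 1 `]-oo, w]).

Lemma normal_cdfE w :
  (normal_cdf w)%:E = normal_prob (0 : R) 1 `]-oo, w].
Proof. by rewrite /normal_cdf fineK// fin_num_measure. Qed.

Lemma normal_cdf_Rintegral w :
  normal_cdf w = \int[mu]_(x in `]-oo, w]) normal_pdf 0 1 x.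
Proof. by []. Qed.

Lemma cvg_normal_cdfNy : normal_cdf w @[w --> -oo] --> (0 : R).
Proof.
have := @cvg_cdfNy0 _ _ _ (normal_prob (0 : R) 1)
  (idTR : {RV normal_prob (0 : R) 1 >-> R}).
by move/fine_cvgP => [_].
Qed.

Lemma cvg_normal_cdfy : normal_cdf w @[w --> +oo] --> (1 : R).
Proof.
have := @cvg_cdfy1 _ _ _ (normal_prob (0 : R) 1)
  (idTR : {RV normal_prob (0 : R) 1 >-> R}).
by move/fine_cvgP => [_].
Qed.

Lemma normal_pdf01E (x : R) :
  normal_pdf 0 1 x = normal_peak 1 * expR (- x ^+ 2 / 2).
Proof. by rewrite normal_pdfE ?oner_neq0// /normal_fun subr0 expr1n. Qed.

Lemma normal_pdf01_gt0 (x : R) : 0 < normal_pdf 0 1 x.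
Proof.
by rewrite normal_pdf01E mulr_gt0 ?expR_gt0// normal_peak_gt0// oner_neq0.
Qed.

Lemma is_derive_normal_pdf01 (x : R) :
  is_derive x 1 (normal_pdf 0 1) (- x * normal_pdf 0 1 x).
Proof.
have -> : normal_pdf 0 1 = (fun x : R => normal_peak 1 * expR (- x ^+ 2 / 2)).
  by apply/funext => y; rewrite normal_pdf01E.
apply: is_derive_eq.
by rewrite /GRing.scale /=; field.
Qed.

End normal_cdf.

(** * The bounded solution of Stein's equation *)

Section stein_solution.
Context {R : realType}.
Local Notation mu := (@lebesgue_measure R).
Local Notation pdf := (@normal_pdf R 0 1).

Definition normal_mean (g : R -> R) : R := \int[mu]_x (g x * pdf x).

Lemma integrable_mul_normal_pdf (h : R -> R) (U : R) (D : set R) :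
  measurable D -> continuous h -> (forall w, `|h w| <= U) ->
  mu.-integrable D (EFin \o (fun x => h x * pdf x)).
Proof.
move=> mD ch hU; apply: (@integrableS _ _ _ _ setT) => //.
have -> : EFin \o (fun x => h x * pdf x) =
  ((EFin \o h) \* (fun x => (pdf x)%:E))%E.
  by apply/funext => x /=; rewrite EFinM.
apply: integrableMr => //.
- exact: continuous_measurable_fun.
- exists U; split; first by rewrite num_real.
  by move=> V UV x _; apply: le_trans (hU x) (ltW UV).
- exact: integrable_normal_pdf.
Qed.

Lemma Rintegral_normal_pdf_le (h : R -> R) (D : set R) :
  measurable D -> continuous h -> (forall w, `|h w| <= 1) ->
  `| \int[mu]_(x in D) (h x * pdf x) | <= \int[mu]_(x in D) pdf x.
Proof.
move=> mD ch h1.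
apply: le_trans (le_normr_Rintegral _ _) _ => //.
  exact: integrable_mul_normal_pdf h1.
have ip : mu.-integrable D (fun x => (pdf x)%:E).
  by apply: integrableS (integrable_normal_pdf 0 1).
apply: le_Rintegral => //.
- have := @integrable_mul_normal_pdf (fun x => `|h x|) 1 D mD.
  have -> : (fun x => `|h x| * pdf x) = (fun x => `|h x * pdf x|).
    by apply/funext => x; rewrite normrM (gtr0_norm (normal_pdf01_gt0 _)).
  apply => [x|w]; last by rewrite normr_id.
  by apply: continuous_comp; [exact: ch|exact: norm_continuous].
- move=> x _; rewrite normrM (gtr0_norm (normal_pdf01_gt0 _)).
  by rewrite ler_piMl// ltW// normal_pdf01_gt0.
Qed.

Lemma Rintegral_normal_pdf_ge (w : R) :
  \int[mu]_(x in `]w, +oo[) pdf x = 1 - normal_cdf w.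
Proof.
have ip : mu.-integrable [set` Interval -oo%O +oo%O] (EFin \o pdf).
  by rewrite set_itvE; exact: (integrable_normal_pdf 0 1).
have := @Rintegral_itvB _ pdf -oo%O +oo%O w ip isT isT.
rewrite [in X in X - _]set_itvE -normal_cdf_Rintegral => <-.
by rewrite /Rintegral integral_normal_pdf.
Qed.

(** The solution is [Psi] / [pdf], where [Psi] is the primitive from -oo of (g - E g(Z)) [pdf].
    Centering g makes [Psi] vanish at +oo as well as at -oo; since exp(- w^2/2) f(w) is a constant
    multiple of [Psi], this is the growth condition of [stein_growth]. *)
Lemma stein_solution (g dg : R -> R) (L : R) :
  (forall w : R, is_derive w 1 g (dg w)) -> (forall w, 0 <= g w <= 1) ->
  (forall w, `|dg w| <= L) ->
  exists (f df : R -> R) (C : R), 0 <= C /\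
    (forall w : R, is_derive w 1 f (df w)) /\
    (forall w, df w = w * f w + (g w - normal_mean g)) /\
    (forall w, [/\ `|f w| <= C, `|w * f w| <= C, `|df w| <= C & `|w * df w| <= C]) /\
    (forall a b, `|df a - df b| <= C * `|a - b|).
Proof.
move=> dg' g01 dgL.
have cd (h dh : R -> R) : (forall w : R, is_derive w 1 h (dh w)) -> continuous h.
  move=> hdh w; apply: differentiable_continuous; apply/derivable1_diffP.
  by have [] := hdh w.
have cg := cd _ _ dg'.
have mT : measurable [set: R] by [].
have g1 w : `|g w| <= 1.
  by have /andP[? ?] := g01 w; rewrite ger0_norm.
set c := normal_mean g.
have ig := integrable_mul_normal_pdf mT cg g1.
have ip : mu.-integrable setT (EFin \o pdf) := integrable_normal_pdf 0 1.
have intpdf : \int[mu]_x pdf x = 1 by rewrite /Rintegral integral_normal_pdf.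
have c01 : 0 <= c <= 1.
  apply/andP; split.
    apply: Rintegral_ge0 => x _; rewrite mulr_ge0//.
      by have /andP[] := g01 x.
    by rewrite ltW// normal_pdf01_gt0.
  have := Rintegral_normal_pdf_le mT cg g1.
  by rewrite -/c intpdf; apply: le_trans; rewrite ler_norm.
pose h x := g x - c.
have ch : continuous h by move=> x; apply: cvgB; [exact: cg|exact: cvg_cst].
have h1 w : `|h w| <= 1.
  have /andP[? ?] := g01 w; case/andP: c01 => ? ?.
  by rewrite /h ler_norml; apply/andP; split; lra.
pose hp x := h x * pdf x.
have ihp D : measurable D -> mu.-integrable D (EFin \o hp).
  by move=> mD; exact: integrable_mul_normal_pdf h1.
have int0 : \int[mu]_x hp x = 0.
  rewrite /hp /h; under eq_Rintegral do rewrite mulrBl.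
  rewrite RintegralB//; last first.
    by apply: (integrable_mul_normal_pdf (U := c)) => //= [|w]; [exact: cst_continuous|rewrite ger0_norm; case/andP: c01].
  by rewrite RintegralZl// intpdf mulr1 subrr.
pose Psi w := \int[mu]_(x in `]-oo, w]) hp x.
have dPsi (w : R) : is_derive w 1 Psi (hp w).
  have cp : continuous pdf by exact: continuous_normal_pdf (oner_neq0 _).
  have w1 : w < w + 1 by rewrite ltrDl.
  have ihpw : mu.-integrable [set` Interval -oo%O (BRight (w + 1))] (EFin \o hp).
    exact: ihp.
  have chp : {for w, continuous hp} by apply: cvgM; [exact: ch|exact: cp].
  have [d1 d2] := continuous_FTC1 w1 ihpw (ltNyr _) chp.
  by apply: DeriveDef; [exact: d1|rewrite -derive1E; exact: d2].
have PsiN w : `|Psi w| <= normal_cdf w.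
  by rewrite normal_cdf_Rintegral; apply: Rintegral_normal_pdf_le.
(* The total integral being 0, [Psi] w is minus the integral over the right tail. *)
have PsiP w : `|Psi w| <= 1 - normal_cdf w.
  have iT : mu.-integrable [set` Interval -oo%O +oo%O] (EFin \o hp) by exact: ihp.
  have := @Rintegral_itvB _ hp -oo%O +oo%O w iT isT isT.
  rewrite [in X in X - _]set_itvE int0 sub0r => /eqP; rewrite eqr_oppLR => /eqP PsiE.
  rewrite /Psi PsiE normrN -Rintegral_normal_pdf_ge.
  exact: Rintegral_normal_pdf_le.
have PsiNy : Psi w @[w --> -oo] --> (0 : R).
  apply/norm_cvg0P; apply: (@squeeze_cvgr _ _ _ _ (cst 0) normal_cdf) => //.
  - by near=> w; rewrite normr_ge0 PsiN.
  - exact: cvg_cst.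
  - exact: cvg_normal_cdfNy.
have Psiy : Psi w @[w --> +oo] --> (0 : R).
  apply/norm_cvg0P; apply: (@squeeze_cvgr _ _ _ _ (cst 0) (fun w => 1 - normal_cdf w)) => //.
  - by near=> w; rewrite normr_ge0 PsiP.
  - exact: cvg_cst.
  - by rewrite -(subrr 1); apply: cvgB; [exact: cvg_cst|exact: cvg_normal_cdfy].
pose f w := Psi w / pdf w.
have pn0 w : pdf w != 0 by rewrite gt_eqF// normal_pdf01_gt0.
have dpdf := @is_derive_normal_pdf01 R.
have df (w : R) : is_derive w 1 f (w * f w + h w).
  have dI := is_deriveV (pn0 w) (dpdf w).
  rewrite /f; apply: is_derive_eq.
  rewrite /GRing.scale /= /hp; field.
  exact: pn0.
have cf := cd _ _ df.
have expf w : expR (- w ^+ 2 / 2) * f w = (normal_peak 1)^-1 * Psi w.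
  rewrite /f normal_pdf01E; field.
  by rewrite !gt_eqF ?expR_gt0// normal_peak_gt0// oner_neq0.
have wf1 : forall w, `|w * f w| <= 1.
  apply: (stein_growth df h1).
  - under eq_fun do rewrite expf.
    by rewrite -(mulr0 (normal_peak 1)^-1); apply: cvgM => //; exact: cvg_cst.
  - under eq_fun do rewrite expf.
    by rewrite -(mulr0 (normal_peak 1)^-1); apply: cvgM => //; exact: cvg_cst.
have [C1 C10 fC1] := bounded_of_growth cf wf1.
(* [k] is f'. In its own equation the source is f + g', bounded by C1 + L, and the growth condition
   is immediate because |k| <= 2. *)
pose k w := w * f w + h w.
have k2 w : `|k w| <= 2.
  by apply: (le_trans (ler_normD _ _)); have := wf1 w; have := h1 w; lra.
pose u w := f w + dg w.
have dk (w : R) : is_derive w 1 k (w * k w + u w).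
  rewrite /k /h; apply: is_derive_eq.
  rewrite /GRing.scale /= /u /k /h; ring.
have uU w : `|u w| <= C1 + L.
  by apply: (le_trans (ler_normD _ _)); apply: lerD.
have cvgE : expR (- w ^+ 2 / 2 : R) @[w --> +oo] --> (0 : R).
  apply: (@squeeze_cvgr _ _ _ _ (cst 0) (fun w => expR (- w))).
  - near=> w; rewrite expR_ge0 ler_expR /=.
    have w2 : 2 <= w by near: w; apply: nbhs_pinfty_ge; rewrite num_real.
    by nra.
  - exact: cvg_cst.
  - exact: cvgr_expR.
have cvgEk (q : R -> R) : (forall w, `|q w| <= 2) ->
    expR (- w ^+ 2 / 2) * q w @[w --> +oo] --> (0 : R).
  move=> q2; apply/norm_cvg0P.
  apply: (@squeeze_cvgr _ _ _ _ (cst 0) (fun w => expR (- w ^+ 2 / 2) * 2)).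
  - near=> w; rewrite normr_ge0 normrM gtr0_norm ?expR_gt0//=.
    by rewrite ler_wpM2l// expR_ge0.
  - exact: cvg_cst.
  - by rewrite -(mul0r 2); apply: cvgM => //; exact: cvg_cst.
have wk : forall w, `|w * k w| <= C1 + L.
  apply: (stein_growth dk uU).
  - exact: cvgEk.
  - rewrite cvgNy_compNP /comp; under eq_fun do rewrite sqrrN.
    exact: cvgEk.
have L0 : 0 <= L by apply: le_trans (dgL 0).
(* Large enough also for |w k + u| = |f''|, which is at most 2 (C1 + L) and gives the Lipschitz
   bound on f'. *)
pose C := 2 + C1 + L + (C1 + L).
exists f, k, C; split; first by rewrite /C; lra.
split=> //; split=> //; split=> [w|a b].
  by split; rewrite /C; [have := fC1 w|have := wf1 w|have := k2 w|have := wk w]; lra.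
have dkC w : `|w * k w + u w| <= C.
  by apply: (le_trans (ler_normD _ _)); have := wk w; have := uU w; rewrite /C; lra.
wlog ab : a b / a <= b.
  move=> H; have [/H//|/ltW/H] := leP a b.
  by rewrite distrC [`|b - a|]distrC.
have [z _ E] := MVT_segment ab (fun x _ => dk x) (continuous_subspaceT (cd _ _ dk)).
by rewrite distrC E normrM [`|a - b|]distrC ler_wpM2r.
Unshelve. all: by end_near.
Qed.

End stein_solution.

(** * The Polya-Aeppli recursion *)

(* With p = 1/(2x) and mu = alpha x^2, this is the recursion satisfied by the
   law q of the local time: in terms of the generating function Q of q it reads
   (1 - (1 - p) X)^2 Q' = p^2 mu Q. *)
Definition polya_aeppli_recursion {R : realType} (p mu : R) (q : nat -> R) :=
  forall m, m.+1%:R * q m.+1 =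
    2 * (1 - p) * (m%:R * q m) - (1 - p) ^+ 2 * (m.-1%:R * q m.-1)
    + p ^+ 2 * mu * q m.

Section polya_aeppli.
Context {R : realType} (p mu : R) (q : nat -> R).
Hypotheses (p01 : 0 < p < 1) (mu0 : 0 < mu).
Hypothesis q0 : forall m, 0 <= q m.
Hypothesis q1 : forall M, \sum_(m < M) q m <= 1.
Hypothesis qrec : polya_aeppli_recursion p mu q.

Let a m := m%:R * q m.

Let a_ge0 m : 0 <= a m. Proof. by rewrite mulr_ge0. Qed.

Let arec m : a m.+1 =
  2 * (1 - p) * a m - (1 - p) ^+ 2 * a m.-1 + p ^+ 2 * mu * q m.
Proof. exact: qrec. Qed.

(** The recursion has the double characteristic root 1 - p, so it splits into two first-order ones,
    for [b] and then for [a]. Summing each of them costs a factor 1/p: from a source of mass at most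
    p^2 mu, the sum of [b] is at most p mu and that of [a] at most mu. *)
Lemma polya_aeppli_mean_le M : \sum_(m < M) m%:R * q m <= mu.
Proof.
have /andP[p0 p1] := p01.
pose b m := a m.+1 - (1 - p) * a m.
have b0 : b 0%N = p ^+ 2 * mu * q 0%N by rewrite /b arec /a /= mul0r; ring.
have bS m : b m.+1 = (1 - p) * b m + p ^+ 2 * mu * q m.+1.
  by rewrite /b arec /=; ring.
have aS m : a m.+1 = (1 - p) * a m + b m by rewrite /b addrC subrK.
have B n : \sum_(m < n) b m <= p * mu.
  case: n => [|n]; first by rewrite big_ord0 mulr_ge0// ltW.
  elim: n => [|n IH].
    rewrite big_ord1 b0; have := q1 1; rewrite big_ord1 => q01.
    have : p ^+ 2 * mu * q 0%N <= p ^+ 2 * mu * 1.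
      by rewrite ler_wpM2l// mulr_ge0// ?sqr_ge0// ltW.
    have : p * mu * p <= p * mu by rewrite ger_pMr ?mulr_gt0// ltW.
    lra.
  rewrite big_ord_recl.
  under eq_bigr do rewrite lift0 bS.
  rewrite big_split /= -!mulr_sumr b0.
  have := q1 n.+2; rewrite big_ord_recl; under eq_bigr do rewrite lift0.
  set S := \sum_(i < n.+1) q i.+1; set T := \sum_(i < n.+1) b i in IH *.
  move=> qS.
  have h1 : (1 - p) * T <= (1 - p) * (p * mu) by rewrite ler_wpM2l// subr_ge0 ltW.
  have h2 : p ^+ 2 * mu * (q 0%N + S) <= p ^+ 2 * mu * 1.
    by rewrite ler_wpM2l// mulr_ge0// ?sqr_ge0// ltW.
  have h3 : p * mu * p <= p * mu by rewrite ger_pMr ?mulr_gt0// ltW.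
  lra.
elim: M => [|M IH]; first by rewrite big_ord0 ltW.
rewrite big_ord_recl mul0r add0r.
under eq_bigr do rewrite lift0 -/(a _) aS.
rewrite big_split /= -mulr_sumr.
have := B M; set T := \sum_(i < M) b i.
have : (1 - p) * \sum_(i < M) a i <= (1 - p) * mu by rewrite ler_wpM2l// subr_ge0 ltW.
by move=> h1 h2; lra.
Qed.

(** Terms of a convergent series; this disposes of the boundary terms at M in
    [polya_aeppli_stein]. *)
Lemma polya_aeppli_cvg0 : m%:R * q m @[m --> \oo] --> (0 : R).
Proof.
apply: cvg_series_cvg_0; apply: nondecreasing_is_cvgn.
  apply/nondecreasing_seqP => n; rewrite /series /= big_nat_recr//= lerDl.
  exact: a_ge0.
exists mu => _ [n _ <-]; rewrite /series /= big_mkord.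
exact: polya_aeppli_mean_le.
Qed.

Section stein.
Variables (sigma : R) (f df : R -> R) (C : R).
Hypotheses (sigma0 : 0 < sigma) (C0 : 0 <= C).
(** The variance mu (2 - p) / p of the compound law, equal to alpha x^2 (4x - 1) when p = 1/(2x) and
    mu = alpha x^2. *)
Hypothesis sigma2 : sigma ^+ 2 = mu * (2 / p - 1).
Hypothesis dfE : forall w : R, is_derive w 1 f (df w).
Hypothesis fC : forall w,
  [/\ `|f w| <= C, `|w * f w| <= C, `|df w| <= C & `|w * df w| <= C].
Hypothesis dfC : forall a b, `|df a - df b| <= C * `|a - b|.

Let h := sigma^-1.
Let s (m : nat) : R := (m%:R - mu) / sigma.

Let h0 : 0 < h. Proof. by rewrite invr_gt0. Qed.

Let sS m : s m.+1 = s m + h.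
Proof. by rewrite /s /h -natr1; field; rewrite gt_eqF. Qed.

(** Multiply the recursion by F(s m), sum, and shift the index in the terms with a (m + 1) and a (m
    - 1): the difference operator moves onto F. Nothing is left at the lower end because a 0 = 0. *)
Lemma polya_aeppli_by_parts (F : R -> R) M :
  \sum_(m < M) (a m * (F (s m - h) - 2 * (1 - p) * F (s m)
      + (1 - p) ^+ 2 * F (s m + h)) - p ^+ 2 * mu * q m * F (s m)) =
  (1 - p) ^+ 2 * F (s M) * a M.-1 - F (s M - h) * a M.
Proof.
elim: M => [|M IH]; first by rewrite big_ord0 /a mul0r !mulr0 subr0.
rewrite big_ord_recr /= IH arec sS addrK.
by ring.
Qed.

Let mvt (w v : R) : w <= v ->
  exists2 z, w <= z <= v & f v - f w = df z * (v - w).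
Proof.
move=> wv.
have cf : continuous f.
  move=> z; apply: differentiable_continuous; apply/derivable1_diffP.
  by have [] := dfE z.
have [z zwv E] := MVT_segment wv (fun x _ => dfE x) (continuous_subspaceT cf).
by exists z => //; move: zwv; rewrite in_itv.
Qed.

Let taylor (w e : R) : `|f (w + e) - f w - e * df w| <= C * e ^+ 2.
Proof.
have [e0|e0] := lerP 0 e.
  have /mvt[z /andP[z1 z2] ->] : w <= w + e by rewrite lerDl.
  have -> : df z * (w + e - w) - e * df w = e * (df z - df w) by ring.
  rewrite normrM (ger0_norm e0) expr2 mulrCA ler_wpM2l//.
  apply: le_trans (dfC _ _) _; rewrite ler_wpM2l// ger0_norm; lra.
have /mvt[z /andP[z1 z2] E] : w + e <= w by lra.
have -> : f (w + e) - f w - e * df w = e * (df z - df w).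
  by rewrite -[f (w + e) - _]opprB E; ring.
rewrite normrM (ltr0_norm e0).
have -> : C * e ^+ 2 = - e * (C * (- e)) by ring.
rewrite ler_wpM2l//; first lra.
apply: le_trans (dfC _ _) _; rewrite ler_wpM2l// ler0_norm; lra.
Qed.

(** Expand [D] m around s m. As 1 - 2 (1 - p) + (1 - p)^2 = p^2, its leading part is q m times p^2
    (m - mu) f - 2 p h m f'. With m - mu = sigma s and m close to mu, both coefficients are close to
    [k], so [D] m is close to k q m (s f - f'), while the sum of [D] is a boundary term. *)
Lemma polya_aeppli_stein M :
  `| \sum_(m < M) q m * (s m * f (s m) - df (s m)) | <=
  C * (h / p + h + p + sigma / mu
       + (M%:R * q M + M.-1%:R * q M.-1) * (sigma / (2 * p * mu))).
Proof.
have /andP[p0 p1] := p01.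
pose D m := a m * (f (s m - h) - 2 * (1 - p) * f (s m)
      + (1 - p) ^+ 2 * f (s m + h)) - p ^+ 2 * mu * q m * f (s m).
pose k := 2 * p * mu * h.
have k0 : 0 < k by rewrite /k !mulr_gt0.
have Eh : h * sigma = 1 by rewrite mulVf// gt_eqF.
(* The choice of sigma enters here: the coefficient p^2 sigma of s f equals [k] up to p^2 mu h. *)
have Es : p ^+ 2 * sigma = mu * h * (2 * p - p ^+ 2).
  have -> : p ^+ 2 * sigma = p ^+ 2 * (h * sigma ^+ 2) by rewrite [sigma ^+ 2]expr2 [h * _]mulrA Eh mul1r.
  by rewrite sigma2; field; rewrite gt_eqF.
(* [c1] gathers the Taylor errors, which weigh on a m and hence cost mu in total; [c2] gathers the s
   f and s f' errors, which weigh on q m and cost 1. *)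
pose c1 := C * (2 * h ^+ 2 + 2 * p * h ^+ 2 + p ^+ 2 * h).
pose c2 := C * (2 * p + mu * p ^+ 2 * h).
have key m : `| k * (q m * (s m * f (s m) - df (s m))) - D m | <=
    a m * c1 + q m * c2.
  have ss : m%:R = mu + sigma * s m by rewrite /s; field; rewrite gt_eqF.
  have [f1 f2 f3 f4] := fC (s m).
  have T1 := taylor (s m) h.
  have := taylor (s m) (- h); rewrite sqrrN mulNr opprK => T2.
  have T3 : `|f (s m + h) - f (s m)| <= C * h.
    have /mvt[z _ ->] : s m <= s m + h by rewrite lerDl ltW.
    have [_ _ dz _] := fC z.
    by rewrite normrM [s m + h]addrC addrK (gtr0_norm h0) ler_wpM2r// ltW.
  set X := f (s m - h) in T2; set Y := f (s m + h) in T1 T3.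
  have -> : k * (q m * (s m * f (s m) - df (s m))) - D m =
    - (a m * (X - f (s m) + h * df (s m) + (Y - f (s m) - h * df (s m)))
     + a m * (2 * p * - (Y - f (s m) - h * df (s m)))
     + a m * (p ^+ 2 * (Y - f (s m))))
    + q m * (2 * p * (s m * df (s m)) + mu * p ^+ 2 * h * (s m * f (s m))).
    have Ek : k * (q m * (s m * f (s m))) = q m * s m * f (s m) *
        (p ^+ 2 * sigma + p ^+ 2 * mu * h) by rewrite Es /k; ring.
    have Eh' : s m = m%:R * h - mu * h by rewrite ss mulrDl mulrAC [sigma * h]mulrC Eh; ring.
    rewrite mulrBr mulrBr Ek /D /a /k -/X -/Y ss.
    have -> : 2 * p * (s m * df (s m)) = 2 * p * ((m%:R * h - mu * h) * df (s m)) by rewrite -Eh'.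
    rewrite ss; ring.
  rewrite (le_trans (ler_normD _ _))// lerD//.
    rewrite normrN -!mulrDr normrM (ger0_norm (a_ge0 m)) ler_wpM2l//.
    have -> : c1 = C * h ^+ 2 + C * h ^+ 2 + 2 * p * (C * h ^+ 2) + p ^+ 2 * (C * h).
      by rewrite /c1; ring.
    have p20 : 0 < 2 * p by rewrite mulr_gt0.
    have B2 : `|2 * p * - (Y - f (s m) - h * df (s m))| <= 2 * p * (C * h ^+ 2).
      by rewrite normrM normrN (gtr0_norm p20) ler_wpM2l// ltW.
    have B3 : `|p ^+ 2 * (Y - f (s m))| <= p ^+ 2 * (C * h).
      by rewrite normrM (ger0_norm (sqr_ge0 p)) ler_wpM2l// sqr_ge0.
    by apply: le_trans (ler_normD _ _) (lerD (le_trans (ler_normD _ _)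
      (lerD (le_trans (ler_normD _ _) (lerD T2 T1)) B2)) B3).
  rewrite normrM (ger0_norm (q0 m)) ler_wpM2l//.
  rewrite (le_trans (ler_normD _ _))// /c2 mulrDr lerD//.
    by rewrite normrM gtr0_norm ?mulr_gt0// [leRHS]mulrC ler_wpM2l// mulr_ge0// ltW.
  have mp : 0 < mu * p ^+ 2 * h by rewrite !mulr_gt0// exprn_gt0.
  by rewrite normrM (gtr0_norm mp) [leRHS]mulrC ler_wpM2l// ltW.
set T := \sum_(m < M) q m * _.
have [hn pn mn] : [/\ 0 <= h, 0 <= p & 0 <= mu] by split; exact: ltW.
have c1_ge0 : 0 <= c1 by rewrite /c1 !(addr_ge0, mulr_ge0, exprn_ge0).
have c2_ge0 : 0 <= c2 by rewrite /c2 !(addr_ge0, mulr_ge0, exprn_ge0).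
have DT : `|k * T - \sum_(m < M) D m| <= mu * c1 + c2.
  rewrite mulr_sumr -sumrB; apply: le_trans (ler_norm_sum _ _ _) _.
  apply: (@le_trans _ _ (\sum_(m < M) (a m * c1 + q m * c2))).
    by apply: ler_sum => m _; exact: key.
  rewrite big_split /= -!mulr_suml lerD//.
    by rewrite ler_wpM2r ?polya_aeppli_mean_le.
  exact: ler_piMl (q1 M).
have DM : `|\sum_(m < M) D m| <= C * (a M + a M.-1).
  rewrite polya_aeppli_by_parts (le_trans (ler_normB _ _))// addrC mulrDr.
  have FC w : `|f w| <= C by have [] := fC w.
  have r1 : `|(1 - p) ^+ 2| <= 1.
    have r0 : 0 <= 1 - p <= 1 by apply/andP; split; lra.
    by case/andP: r0 => r0 r1; rewrite ger0_norm ?exprn_ge0// exprn_ile1.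
  apply: lerD; rewrite normrM (ger0_norm (a_ge0 _)) ler_wpM2r//.
  by rewrite normrM -[leRHS]mul1r ler_pM.
rewrite -(ler_pM2l k0) -{1}(gtr0_norm k0) -normrM.
have : `|k * T| <= mu * c1 + c2 + C * (a M + a M.-1).
  have -> : k * T = (k * T - \sum_(m < M) D m) + \sum_(m < M) D m by rewrite subrK.
  by rewrite (le_trans (ler_normD _ _))// lerD.
move/le_trans; apply; rewrite le_eqVlt; apply/orP; left; apply/eqP.
rewrite /c1 /c2 /k /a /h; field.
by rewrite !gt_eqF.
Qed.
End stein.
End polya_aeppli.

(** * Logistic functions as smooth indicators of half-lines *)

Section logistic.
Context {R : realType}.

Definition logistic (K b w : R) : R := (1 + expR (K * (w - b)))^-1.

Let den_gt0 (K b w : R) : 0 < 1 + expR (K * (w - b)).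
Proof. by rewrite addr_gt0// expR_gt0. Qed.

Lemma logistic01 K b w : 0 <= logistic K b w <= 1.
Proof.
rewrite /logistic invr_ge0 (ltW (den_gt0 _ _ _))/= invf_le1//.
by rewrite lerDl expR_ge0.
Qed.

Lemma is_derive_logistic (K b w : R) : is_derive w 1 (logistic K b)
  (- (K * expR (K * (w - b)) / (1 + expR (K * (w - b))) ^+ 2)).
Proof.
have d1 : is_derive w 1 (fun w : R => 1 + expR (K * (w - b))) (K * expR (K * (w - b))).
  by apply: is_derive_eq; rewrite /GRing.scale /=; ring.
have n0 : 1 + expR (K * (w - b)) != 0 by rewrite gt_eqF.
have dI := @is_deriveV _ (fun w : R => 1 + expR (K * (w - b))) _ _ _ n0 d1.
by apply: (is_derive_eq dI); rewrite /GRing.scale /=; field.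
Qed.

Lemma logistic_lipschitz (K b w : R) : 0 <= K ->
  `|- (K * expR (K * (w - b)) / (1 + expR (K * (w - b))) ^+ 2)| <= K.
Proof.
move=> K0; have e0 := expR_ge0 (K * (w - b)); have d0 := den_gt0 K b w.
rewrite normrN ger0_norm; last by rewrite divr_ge0 ?mulr_ge0 ?exprn_ge0// ltW.
rewrite ler_pdivrMr ?exprn_gt0// ler_wpM2l//; nra.
Qed.

(** With steepness 1/(e a), the exponent has absolute value at least 1/e beyond distance a from b;
    since exp(1/e) >= 1/e, the logistic function is then within e of 0 or 1. *)
Lemma logistic_step (a e b w : R) : 0 < a -> 0 < e ->
  (w <= b - a)%R%:R - e <= logistic (e * a)^-1 b w <= (w <= b + a)%R%:R + e.
Proof.
move=> a0 e0; set K := (e * a)^-1.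
have K0 : 0 < K by rewrite invr_gt0 mulr_gt0.
have Ka : K * a = e^-1 by rewrite /K; field; rewrite !gt_eqF.
have big_exp y : a <= y -> e^-1 <= expR (K * y).
  move=> ay; apply: (@le_trans _ _ (K * y)).
    by rewrite -Ka ler_wpM2l// ltW.
  by apply: le_trans (expR_ge1Dx _); rewrite lerDr.
have /andP[g0 g1] := logistic01 K b w.
apply/andP; split.
  have [wb|wb] := leP w (b - a); last by rewrite sub0r (le_trans _ g0)// oppr_le0 ltW.
  have := big_exp (b - w); rewrite lerBrDr addrC -lerBrDr => /(_ wb) H.
  have E : expR (K * (w - b)) <= e.
    rewrite -[w - b]opprB mulrN expRN -[leRHS]invrK lef_pV2// ?posrE ?expR_gt0//.
    by rewrite invr_gt0.
  rewrite /logistic -[leRHS]mul1r ler_pdivlMr//.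
  have := expR_ge0 (K * (w - b)); set z := expR _ in E *; move=> z0.
  rewrite /= mulrDr mulr1 mulrDl; nra.
have [wb|wb] := leP w (b + a); first by rewrite (le_trans g1)// lerDl ltW.
have H : e^-1 <= expR (K * (w - b)) by apply: big_exp; lra.
rewrite add0r /logistic -[leRHS]invrK lef_pV2// ?posrE ?invr_gt0//.
by rewrite (le_trans H)// lerDr.
Qed.

End logistic.

Section normal_cdf_bounds.
Context {R : realType}.
Local Notation mu := (@lebesgue_measure R).

Lemma normal_cdf_lipschitz (v w : R) : v <= w ->
  normal_cdf w - normal_cdf v <= normal_peak 1 * (w - v).
Proof.
move=> vw.
have ip : mu.-integrable setT (EFin \o normal_pdf 0 1).
  exact: (integrable_normal_pdf 0 1).
rewrite !normal_cdf_Rintegral.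
have iw : mu.-integrable [set` Interval -oo%O (BRight w)] (EFin \o normal_pdf 0 1).
  exact: integrableS ip.
have -> := @Rintegral_itvB _ (normal_pdf 0 1) -oo%O (BRight w) v iw isT vw.
have mvw : mu `]v, w] = (w - v)%:E.
  move: vw; rewrite lebesgue_measure_itv /= lte_fin le_eqVlt.
  by move=> /predU1P[->|->]; rewrite ?ltxx ?subrr// EFinB.
apply: (@le_trans _ _ (\int[mu]_(x in `]v, w]) normal_peak 1)).
  apply: le_Rintegral => //.
  - exact: integrableS ip.
  - apply: measurable_bounded_integrable => //; first by apply: (@eq_ind_r _ _ (fun z => (z < +oo)%E) _ _ mvw); rewrite ltry.
    exact: bounded_cst.
  - by move=> x _; apply: normal_pdf_ub; rewrite oner_neq0.
rewrite Rintegral_cst// le_eqVlt; apply/orP; left; apply/eqP.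
congr (_ * _); exact: (congr1 fine mvw).
Qed.

(** This is [logistic_step] integrated against the density, the line being cut at b - a for the
    lower bound and at b + a for the upper one. *)
Lemma normal_mean_logistic (a e b : R) : 0 < a -> 0 < e ->
  normal_cdf (b - a) - e <= normal_mean (logistic (e * a)^-1 b)
    <= normal_cdf (b + a) + e.
Proof.
move=> a0 e0; set g := logistic _ _.
have ip : mu.-integrable setT (EFin \o normal_pdf 0 1).
  exact: (integrable_normal_pdf 0 1).
have cg : continuous g.
  move=> z; apply: differentiable_continuous; apply/derivable1_diffP.
  by have [] := is_derive_logistic (e * a)^-1 b z.
have g1 w : `|g w| <= 1.
  by have /andP[? ?] := logistic01 (e * a)^-1 b w; rewrite ger0_norm.
have ig D : measurable D -> mu.-integrable D (EFin \o (fun x => g x * normal_pdf 0 1 x)).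
  by move=> mD; exact: integrable_mul_normal_pdf g1.
have ik k D : measurable D -> mu.-integrable D (EFin \o (fun x => k * normal_pdf 0 1 x)).
  move=> mD; apply: (integrable_mul_normal_pdf (h := fun=> k) (U := `|k|)) => //.
  exact: cst_continuous.
have split c : normal_mean g = \int[mu]_(x in `]-oo, c]) (g x * normal_pdf 0 1 x)
    + \int[mu]_(x in `]c, +oo[) (g x * normal_pdf 0 1 x).
  have iT : mu.-integrable [set` Interval -oo%O +oo%O]
      (EFin \o (fun x => g x * normal_pdf 0 1 x)) by exact: ig.
  have := @Rintegral_itvB _ _ -oo%O +oo%O c iT isT isT.
  by rewrite [in X in X - _]set_itvE => <-; rewrite addrC subrK.
have intk k c : \int[mu]_(x in `]-oo, c]) (k * normal_pdf 0 1 x) = k * normal_cdf c.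
  by rewrite RintegralZl//; apply: integrableS ip.
have cdf0 c : 0 <= normal_cdf c by rewrite fine_ge0.
have cdf1 c : normal_cdf c <= 1.
  by rewrite -lee_fin normal_cdfE probability_le1.
have pdf0 (x : R) : 0 <= normal_pdf 0 1 x by rewrite ltW// normal_pdf01_gt0.
apply/andP; split.
  rewrite (split (b - a)); apply: (@le_trans _ _ ((1 - e) * normal_cdf (b - a))).
    by rewrite mulrBl mul1r lerB// ler_piMr ?cdf1// ltW.
  apply: ler_wpDr.
    apply: Rintegral_ge0 => x _; rewrite mulr_ge0//.
    by have /andP[] := logistic01 (e * a)^-1 b x.
  rewrite -intk; apply: le_Rintegral; [by []|exact: ik|exact: ig|].
  move=> x /=; rewrite in_itv /= => xb; rewrite ler_wpM2r//.
  by have /andP[+ _] := logistic_step b x a0 e0; rewrite xb.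
rewrite (split (b + a)); apply: lerD.
  rewrite -[leRHS]mul1r -intk; apply: le_Rintegral; [by []|exact: ig|exact: ik|].
  move=> x _; rewrite ler_wpM2r//.
  by have /andP[] := logistic01 (e * a)^-1 b x.
apply: (@le_trans _ _ (\int[mu]_(x in `]b + a, +oo[) (e * normal_pdf 0 1 x))).
  apply: le_Rintegral; [by []|exact: ig|exact: ik|].
  move=> x /=; rewrite in_itv /= andbT => xb; rewrite ler_wpM2r//.
  have /andP[_] := logistic_step b x a0 e0.
  by rewrite (_ : (x <= b + a) = false) ?add0r//; apply/negbTE; rewrite -ltNge.
rewrite RintegralZl//; last exact: integrableS ip.
rewrite Rintegral_normal_pdf_ge ler_piMr//; first exact: ltW.
by rewrite lerBlDr lerDl cdf0.
Qed.

End normal_cdf_bounds.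

(** * From the recursion to the normal limit *)

Section polya_aeppli_clt.
Context {R : realType} (alpha : R) (alpha0 : 0 < alpha) (q : nat -> nat -> R).
Hypothesis q0 : forall x m, 0 <= q x m.
Hypothesis q1 : forall x, (0 < x)%N -> \sum_(m < M) q x m @[M --> \oo] --> (1 : R).
Hypothesis qrec : forall x, (0 < x)%N ->
  polya_aeppli_recursion (2 * x%:R)^-1 (alpha * x%:R ^+ 2) (q x).

Let sigma (x : nat) : R := x%:R * Num.sqrt (alpha * (4 * x%:R - 1)).
Let s (x m : nat) : R := (m%:R - alpha * x%:R ^+ 2) / sigma x.

Let partial_le1 x : (0 < x)%N -> forall M, \sum_(m < M) q x m <= 1.
Proof.
move=> x0 M; rewrite -(cvg_lim (@Rhausdorff R) (q1 x0)); apply: limr_ge.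
  by apply/cvg_ex; exists 1; exact: q1.
near=> N.
have MN : (M <= N)%N by near: N; exact: nbhs_infty_ge.
rewrite -!(big_mkord xpredT (q x)) (big_cat_nat _ MN)//= lerDl.
exact: sumr_ge0.
Unshelve. all: by end_near.
Qed.

(** M is chosen after x: the boundary terms vanish only for fixed x, whereas the other error, C
    times [err] x, does not depend on M. *)
Lemma polya_aeppli_logistic (K b e : R) : 0 <= K -> 0 < e ->
  \forall x \near \oo, \forall M \near \oo, 1 - e <= \sum_(m < M) q x m /\
    `|\sum_(m < M) q x m * logistic K b (s x m) - normal_mean (logistic K b)| <= e.
Proof.
move=> K0 e0; set g := logistic K b.
have [f [df [C [C0 [dfE [eqn [fC dfC]]]]]]] := stein_solution
  (is_derive_logistic K b) (logistic01 K b) (fun w => logistic_lipschitz b w K0).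
pose y (x : nat) := Num.sqrt (alpha * (4 * x%:R - 1)) : R.
(* 7 = 2 + 1 + 4, from 1/(sigma p) = 2/y, 1/sigma <= 1/y and sigma/mu <= 4/y; the last term is p. *)
pose err (x : nat) := 7 / y x + (2 * x%:R)^-1.
pose N := `|normal_mean g| + 1.
have N0 : 0 < N by rewrite ltr_wpDl.
(* Replacing the partial sum of q by 1 costs the missing mass times the normal mean of g, whence the
   division by [N]. *)
pose e' := e / (4 * N).
have e'0 : 0 < e' by rewrite divr_gt0 ?mulr_gt0.
have e'e : e' <= e / 4.
  by rewrite /e' ler_pM2l// lef_pV2 ?posrE ?mulr_gt0// ler_peMr// lerDr.
have invy : (y x)^-1 @[x --> \oo] --> (0 : R).
  apply/cvgr0Pnorm_le => d d0; near=> x.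
  have x0 : (0 < x)%N by near: x; exact: nbhs_infty_gt.
  have x1 : 1 <= x%:R :> R by rewrite ler1n.
  have xd : (alpha * d ^+ 2)^-1 <= x%:R.
    by near: x; exact: nbhs_infty_ger.
  have yx : 0 < y x by rewrite sqrtr_gt0 mulr_gt0//; lra.
  rewrite normfV (gtr0_norm yx) invf_ple ?posrE//.
  have -> : d^-1 = Num.sqrt (d^-1 ^+ 2) by rewrite sqrtr_sqr ger0_norm// invr_ge0 ltW.
  apply: ler_wsqrtr; rewrite exprVn.
  have -> : d ^- 2 = alpha * (alpha * d ^+ 2)^-1 by field; rewrite !gt_eqF.
  by rewrite ler_pM2l// (le_trans xd)//; lra.
have cvg_err : C * err x @[x --> \oo] --> (0 : R).
  rewrite -(mulr0 C); apply: cvgM; first exact: cvg_cst.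
  rewrite -(addr0 0); apply: cvgD.
    by rewrite -(mulr0 7); apply: cvgM => //; exact: cvg_cst.
  under eq_fun do rewrite invfM.
  rewrite -(mulr0 2^-1); apply: cvgM; first exact: cvg_cst.
  rewrite gtr0_cvgV0; first exact: cvgr_idn.
  by near=> z; rewrite ltr0n; near: z; exact: nbhs_infty_gt.
near=> x.
have x0 : (0 < x)%N by near: x; exact: nbhs_infty_gt.
have xR : 0 < x%:R :> R by rewrite ltr0n.
have x1 : 1 <= x%:R :> R by rewrite ler1n.
have r0 : 0 < alpha * (4 * x%:R - 1) by rewrite mulr_gt0//; lra.
have y0 : 0 < y x by rewrite sqrtr_gt0.
have yy : y x ^+ 2 = alpha * (4 * x%:R - 1) by rewrite sqr_sqrtr// ltW.
have s0 : 0 < sigma x by rewrite mulr_gt0.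
set p := (2 * x%:R)^-1 : R; set mu := alpha * x%:R ^+ 2.
have p01 : 0 < p < 1.
  rewrite invr_gt0 mulr_gt0//= invf_lt1 ?mulr_gt0//; lra.
have mu0 : 0 < mu by rewrite mulr_gt0// exprn_gt0.
have s2 : sigma x ^+ 2 = mu * (2 / p - 1).
  by rewrite /sigma exprMn yy /mu /p; field; rewrite gt_eqF.
have main := polya_aeppli_stein p01 mu0 (q0 x) (partial_le1 x0) (qrec x0)
  s0 C0 s2 dfE fC dfC.
have a0cvg := polya_aeppli_cvg0 p01 mu0 (q0 x) (partial_le1 x0) (qrec x0).
set k := sigma x / (2 * p * mu) in main.
have errE : (sigma x)^-1 / p + (sigma x)^-1 + p + sigma x / mu <= err x.
  have E1 : (sigma x)^-1 / p = 2 / y x.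
    by rewrite /sigma -/(y x) /p; field; rewrite !gt_eqF.
  have E2 : (sigma x)^-1 <= 1 / y x.
    rewrite /sigma -/(y x) invfM ler_pM2r ?invr_gt0//.
    by rewrite invf_le1.
  have E3 : sigma x / mu <= 4 / y x.
    rewrite ler_pdivlMr// mulrAC ler_pdivrMr// /sigma -/(y x) -mulrA -expr2 yy /mu.
    have -> : x%:R * (alpha * (4 * x%:R - 1)) = 4 * (alpha * x%:R ^+ 2) - alpha * x%:R by ring.
    by rewrite gerBl mulr_ge0// ltW.
  rewrite E1 /err -/p; lra.
have lim0 : C * ((M%:R * q x M + M.-1%:R * q x M.-1) * k) @[M --> \oo] --> (0 : R).
  rewrite -(mulr0 C); apply: cvgM; first exact: cvg_cst.
  rewrite -(mul0r k); apply: cvgM; last exact: cvg_cst.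
  rewrite -(addr0 0); apply: cvgD; first exact: a0cvg.
  by rewrite -cvg_shiftS.
have nM1 : \forall M \near \oo, 1 - e' <= \sum_(m < M) q x m.
  have e1 : 1 - e' < 1 by rewrite gtrBl.
  exact: (cvgr_ge _ (q1 x0) _ e1).
have e40 : 0 < e / 4 by rewrite divr_gt0.
have nM2 := cvgr_le _ lim0 _ e40.
near=> M.
have M1 : 1 - e' <= \sum_(m < M) q x m by near: M.
split; first by apply: le_trans M1; lra.
have H : `|\sum_(m < M) q x m * (g (s x m) - normal_mean g)| <= e / 4 + e / 4.
  have -> : \sum_(m < M) q x m * (g (s x m) - normal_mean g) =
      - \sum_(m < M) q x m * (s x m * f (s x m) - df (s x m)).
    by rewrite -sumrN; apply: eq_bigr => m _; rewrite eqn /g; ring.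
  rewrite normrN; apply: (le_trans (main M)).
  rewrite mulrDr; apply: lerD; last by (near: M; exact: nM2).
  apply: (@le_trans _ _ (C * err x)); first by rewrite ler_wpM2l.
  by near: x; apply: (cvgr_le _ cvg_err); rewrite divr_gt0.
have -> : \sum_(m < M) q x m * g (s x m) - normal_mean g =
    \sum_(m < M) q x m * (g (s x m) - normal_mean g)
    - normal_mean g * (1 - \sum_(m < M) q x m).
  under [in RHS]eq_bigr do rewrite mulrBr.
  by rewrite sumrB -mulr_suml; ring.
apply: (le_trans (ler_normB _ _)).
have -> : e = (e / 4 + e / 4) + N * (2 * e') by rewrite /e'; field; rewrite gt_eqF.
rewrite lerD// normrM ler_pM//; first by rewrite lerDl.
rewrite ger0_norm ?subr_ge0 ?partial_le1//; lra.
Unshelve. all: by end_near.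
Qed.

(** [F] stands for the distribution function at t. It is only sandwiched up to the mass of q beyond
    M, so that every estimate stays within finite sums. *)
Lemma polya_aeppli_clt (t : R) (F : nat -> R) :
  (forall x, (0 < x)%N -> forall M, \sum_(m < M) q x m * (s x m <= t)%R%:R <= F x
     <= \sum_(m < M) q x m * (s x m <= t)%R%:R + (1 - \sum_(m < M) q x m)) ->
  F x @[x --> \oo] --> normal_cdf t.
Proof.
move=> FE; apply/cvgrPdist_le => e e0.
(* At most five errors [eta] add up: the step approximation, the missing mass, the Stein estimate,
   the normal mean, and the shift by 2 a, which moves [normal_cdf] by at most [eta]. *)
pose eta := e / 8.
have eta0 : 0 < eta by rewrite divr_gt0.
have pk : 0 < normal_peak (1 : R) by rewrite normal_peak_gt0 ?oner_neq0.
pose a := eta / (2 * normal_peak 1).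
have a0 : 0 < a by rewrite divr_gt0 ?mulr_gt0.
have Lip u : normal_cdf (u + 2 * a) <= normal_cdf u + eta.
  rewrite [leRHS]addrC -lerBlDr; apply: (le_trans (normal_cdf_lipschitz _)).
    by rewrite lerDl mulr_ge0// ltW.
  by rewrite le_eqVlt; apply/orP; left; apply/eqP; rewrite /a; field; rewrite gt_eqF.
have K0 : 0 <= (eta * a)^-1 by rewrite invr_ge0 mulr_ge0 ?ltW.
(* Centred at t + a, the logistic function is at least 1 - eta up to t, which gives the upper
   estimate; centred at t - a it is at most eta beyond t, which gives the lower one. *)
have [X1 _ nU] := polya_aeppli_logistic (t + a) K0 eta0.
have [X2 _ nL] := polya_aeppli_logistic (t - a) K0 eta0.
exists (maxn 1 (maxn X1 X2)) => // x /=; rewrite !geq_max => /andP[x0 /andP[xU xL]].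
have [N1 _ HU] := nU x xU; have [N2 _ HL] := nL x xL; pose M := maxn N1 N2.
have [M1 MU] := HU M (leq_maxl _ _); have [_ ML] := HL M (leq_maxr _ _).
have P1 := partial_le1 x0 M.
have /andP[F1 F2] := FE x x0 M.
have etaq : eta * \sum_(m < M) q x m <= eta by rewrite ler_piMr// ltW.
have U : \sum_(m < M) q x m * (s x m <= t)%R%:R <=
    \sum_(m < M) q x m * logistic (eta * a)^-1 (t + a) (s x m) + eta.
  apply: (@le_trans _ _ (\sum_(m < M) q x m * (logistic (eta * a)^-1 (t + a) (s x m) + eta))).
    apply: ler_sum => m _; rewrite ler_wpM2l//.
    by have /andP[+ _] := logistic_step (t + a) (s x m) a0 eta0; rewrite addrK lerBlDr.
  under eq_bigr do rewrite mulrDr.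
  by rewrite big_split /= -mulr_suml lerD2l mulrC.
have L : \sum_(m < M) q x m * logistic (eta * a)^-1 (t - a) (s x m) - eta <=
    \sum_(m < M) q x m * (s x m <= t)%R%:R.
  rewrite lerBlDr.
  apply: (@le_trans _ _ (\sum_(m < M) q x m * ((s x m <= t)%R%:R + eta))).
    apply: ler_sum => m _; rewrite ler_wpM2l//.
    by have /andP[_] := logistic_step (t - a) (s x m) a0 eta0; rewrite subrK.
  under eq_bigr do rewrite mulrDr.
  by rewrite big_split /= -mulr_suml lerD2l mulrC.
have /andP[_ NU] := normal_mean_logistic (t + a) a0 eta0.
have /andP[NL _] := normal_mean_logistic (t - a) a0 eta0.
have := Lip t; have := Lip (t - 2 * a).
rewrite subrK => L1 L2.
have E1 : t + a + a = t + 2 * a by ring.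
have E2 : t - a - a = t - 2 * a by ring.
rewrite E1 in NU; rewrite E2 in NL.
move: MU ML; rewrite !ler_norml => /andP[MU1 MU2] /andP[ML1 ML2].
have ee : e = 8 * eta by rewrite /eta; field.
clear -U L F1 F2 NU NL L1 L2 MU1 MU2 ML1 ML2 ee M1 eta0.
by rewrite ee; apply/andP; split; lra.
Qed.
End polya_aeppli_clt.

(** * Returns of the conditioned walk *)

(** The starting point is not listed. Paths through 0, where the predecessor stays at 0 by default,
    are harmless: the step from 1 to 0 has weight 0. *)
Fixpoint nn_paths (n y : nat) : seq (seq nat) :=
  if n is m.+1 then
    map (cons y.+1) (nn_paths m y.+1) ++ map (cons y.-1) (nn_paths m y.-1)
  else [:: [::]].

Fixpoint path_weight {R : realType} (y : nat) (s : seq nat) : R :=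
  if s is z :: s' then conditioned_step y%:Z z%:Z * path_weight z s' else 1.

(* Probability that the conditioned walk started at y visits x less than k
   times during [1, n]. *)
Definition few_visits {R : realType} (x n k y : nat) : R :=
  \sum_(s <- nn_paths n y) path_weight y s * (count_mem x s < k)%N%:R.

Section few_visits.
Context {R : realType}.
Local Notation V := (@few_visits R).

Lemma size_nn_paths n y s : s \in nn_paths n y -> size s = n.
Proof.
elim: n y s => [|n IH] y s /=; first by rewrite inE => /eqP->.
by rewrite mem_cat => /orP[] /mapP[s' /IH {IH} <- ->].
Qed.

Lemma uniq_nn_paths n y : uniq (nn_paths n y).
Proof.
elim: n y => [//|n IH] y /=; rewrite cat_uniq !map_inj_uniq ?IH; last 2 first.
- by move=> ? ? [].
- by move=> ? ? [].
rewrite andbT /=; apply/hasPn => s /mapP[s' _ ->]; apply/mapP => -[s'' _ [E _]].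
by move: E => /eqP; case: y => [|y] //=; rewrite ltn_eqF// ltnS leqnSn.
Qed.

Lemma conditioned_stepS (y : nat) :
  conditioned_step y%:Z y.+1%:Z = y.+1%:R / (2 * y%:R) :> R.
Proof. by rewrite /conditioned_step -addn1 PoszD addrC addKr. Qed.

Lemma conditioned_step_pred (y : nat) :
  conditioned_step y%:Z y.-1%:Z = y.-1%:R / (2 * y%:R) :> R.
Proof.
case: y => [|y]; first by rewrite /conditioned_step /= !mul0r.
rewrite /conditioned_step /= -[y.+1]addn1 PoszD opprD addrA subrr sub0r.
by [].
Qed.

(** The Markov property at time 1: a first step onto x uses up one of the allowed visits. Truncated
    subtraction at k = 0 is correct, as [V] is 0 there. *)
Lemma few_visitsS x n k y : V x n.+1 k y =
  y.+1%:R / (2 * y%:R) * V x n (k - (y.+1 == x)) y.+1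
  + y.-1%:R / (2 * y%:R) * V x n (k - (y.-1 == x)) y.-1.
Proof.
rewrite /few_visits /= big_cat /= !big_map -conditioned_stepS -conditioned_step_pred.
by congr (_ + _); rewrite mulr_sumr; apply: eq_bigr => s _; rewrite mulrA ltn_subRL.
Qed.

Lemma few_visits0 x k y : V x 0 k y = (0 < k)%N%:R.
Proof. by rewrite /few_visits big_seq1 /= mul1r. Qed.

Lemma few_visits_ge0 x n k y : 0 <= V x n k y.
Proof.
elim: n k y => [|n IH] k y; first by rewrite few_visits0.
by rewrite few_visitsS addr_ge0// !mulr_ge0// invr_ge0 mulr_ge0.
Qed.

Lemma few_visits_k0 x n y : V x n 0 y = 0.
Proof.
elim: n y => [|n IH] y; first by rewrite few_visits0.
by rewrite few_visitsS !sub0n !IH !mulr0 addr0.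
Qed.

Lemma few_visits_noninc x n k y : V x n.+1 k y <= V x n k y.
Proof.
elim: n k y => [|n IH] k y; last first.
  rewrite few_visitsS [leRHS]few_visitsS lerD// ler_wpM2l// divr_ge0// mulr_ge0//.
rewrite few_visitsS !few_visits0.
case: k => [|k]; first by rewrite !mulr0 addr0.
apply: (@le_trans _ _ (y.+1%:R / (2 * y%:R) * 1 + y.-1%:R / (2 * y%:R) * 1)).
  by rewrite lerD// ler_wpM2l ?divr_ge0 ?mulr_ge0// lern1 leq_b1.
case: y => [|y]; first by rewrite mulr0 invr0 !(mulr0, mul0r, addr0).
rewrite le_eqVlt; apply/orP; left; apply/eqP; rewrite -!natr1 /=.
by field; rewrite natr1 pnatr_eq0.
Qed.

Lemma few_visits_le1 x n k y : V x n k y <= 1.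
Proof.
elim: n => [|n IH]; first by rewrite few_visits0 lern1 leq_b1.
exact: le_trans (few_visits_noninc _ _ _ _) IH.
Qed.

(** In n steps there are at most n visits, so this says that the path weights have total mass 1. *)
Lemma few_visits_total x n k y : (0 < y)%N -> (n < k)%N -> V x n k y = 1.
Proof.
elim: n k y => [|n IH] k y y0 nk; first by rewrite few_visits0 nk.
have nk' z : (n < k - (z == x))%N.
  by rewrite ltn_subRL (leq_ltn_trans _ nk)//; case: (z == x).
rewrite few_visitsS IH//.
case: y y0 => [//|[|y] _]; first by rewrite /= !mul0r addr0; field.
by rewrite IH//= -!natr1; field; rewrite !natr1 pnatr_eq0.
Qed.

Let p (x : nat) : R := (2 * x%:R)^-1.
(** The number of returns to x is geometric, p x being the probability of never returning. *)
Let e (x k : nat) : R := 1 - (1 - p x) ^+ k.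

Lemma affine_from0 (d : nat -> R) (x : nat) :
  (forall y, (0 < y < x)%N -> 2 * d y = d y.+1 + d y.-1) -> d 0%N = 0 ->
  forall y, (0 < y <= x)%N -> d y = d 1%N *+ y.
Proof.
move=> H d0; elim/ltn_ind => -[//|[|y]] IH; first by [].
move=> /andP[_ yx].
have := H y.+1; rewrite yx /= => /(_ isT).
rewrite IH ?(ltnW yx)//.
have -> : d y = d 1%N *+ y.
  by case: y IH yx => [|y] IH yx; [rewrite d0|rewrite IH// (ltnW (ltnW yx))].
move/eqP; rewrite -subr_eq => /eqP <-.
by rewrite !mulrS; ring.
Qed.

(* Off x, the limit of y V(k, y) is harmonic in y, hence affine on each side
   of x; [phi k] is its value, continued to x from either side. *)
Lemma cvg_few_visits x k : (0 < x)%N -> V x n k x @[n --> \oo] --> e x k.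
Proof.
move=> x0; have xn0 : x%:R != 0 :> R by rewrite pnatr_eq0 -lt0n.
have nS (z : nat) : z.+1%:R = z%:R + 1 :> R by rewrite -natr1.
have V_cvg j y : cvgn (fun n => V x n j y).
  apply: nonincreasing_is_cvgn.
    by apply/nonincreasing_seqP => n; exact: few_visits_noninc.
  by exists 0 => _ [n _ <-]; exact: few_visits_ge0.
pose L j y := limn (fun n => V x n j y).
have VL j y : V x n j y @[n --> \oo] --> L j y by exact: V_cvg.
(* The factor y undoes the Doob transform: y L(j, y) is averaged by the simple random walk. *)
have LE j y : (0 < y)%N -> 2 * (L j y * y%:R) =
    L (j - (y.+1 == x))%N y.+1 * y.+1%:R + L (j - (y.-1 == x))%N y.-1 * y.-1%:R.
  move=> y0; have yn0 : y%:R != 0 :> R by rewrite pnatr_eq0 -lt0n.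
  have H1 : V x n.+1 j y @[n --> \oo] --> L j y.
    by have := VL j y; rewrite -(cvg_shiftS (fun n => V x n j y)).
  have H2 : V x n.+1 j y @[n --> \oo] -->
      y.+1%:R / (2 * y%:R) * L (j - (y.+1 == x))%N y.+1
      + y.-1%:R / (2 * y%:R) * L (j - (y.-1 == x))%N y.-1.
    under eq_fun do rewrite few_visitsS.
    by apply: cvgD; apply: cvgM; [exact: cvg_cst|exact: VL|exact: cvg_cst|exact: VL].
  rewrite (cvg_unique (@Rhausdorff R) H1 H2).
  by field.
have L0 j y : 0 <= L j y.
  by apply: limr_ge => //; apply: nearW => n; exact: few_visits_ge0.
have L1 j y : L j y <= 1.
  by apply: limr_le => //; apply: nearW => n; exact: few_visits_le1.
have Lk0 y : L 0%N y = 0.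
  rewrite /L (_ : (fun n => _) = cst 0) ?lim_cst//.
  by apply/funext => n; rewrite few_visits_k0.
suff : L k x = e x k by move=> <-; exact: VL.
have e01 j : 0 <= e x j <= 1.
  have x1 : 1 <= x%:R :> R by rewrite ler1n.
  have p1 : p x <= 1 by rewrite /p invf_le1 ?mulr_gt0 ?ltr0n//; lra.
  have p0 : 0 <= p x by rewrite invr_ge0 mulr_ge0.
  by rewrite /e subr_ge0 exprn_ile1 ?gerBl ?exprn_ge0 ?subr_ge0.
have eS j : 2 * (e x j.+1 * x%:R) = 1 + (2 * x%:R - 1) * e x j.
  by rewrite /e exprS /p; field.
(* Two lines meeting at x: the left one vanishes at 0; the right one has slope 1, the only slope
   compatible with L <= 1 and with the bound [lower]. *)
pose phi j y : R := if (y <= x)%N then y%:R * e x j else y%:R - x%:R + x%:R * e x j.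
have phi_up j y : (x <= y)%N -> phi j y = y%:R - x%:R + x%:R * e x j.
  rewrite /phi leq_eqVlt => /predU1P[<-|]; first by rewrite leqnn subrr add0r.
  by rewrite ltnNge => /negbTE->.
have phi_harm j y : (0 < y)%N -> y != x -> 2 * phi j y = phi j y.+1 + phi j y.-1.
  case: y => [//|y] _ yx; rewrite succnK; have [yx'|yx'|E] := ltngtP y.+1 x.
  - have h1 : (y.+1 <= x)%N := ltnW yx'.
    by rewrite /phi yx' h1 (ltnW h1) !nS; ring.
  - have xy : (x <= y)%N := yx'.
    rewrite (phi_up _ _ xy) (phi_up _ _ (leqW xy)) (phi_up _ _ (leqW (leqW xy))).
    by rewrite !nS; ring.
  - by rewrite E eqxx in yx.
have phi_x j : phi j x.+1 + phi j x.-1 = 2 * (e x j.+1 * x%:R).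
  have xE : x.-1%:R = x%:R - 1 :> R by rewrite -[in RHS](prednK x0) nS addrK.
  by rewrite eS phi_up// /phi leq_pred xE nS; ring.
elim: k => [|k IH]; first by rewrite Lk0 /e expr0 subrr.
(* A bound valid at every finite time, by induction on n: the neighbours contribute at least [phi],
   whose average is [phi] off x and x e(j + 1) at x. In the limit it keeps the slope to the right of
   x from being below 1. *)
have lower n j y : (0 < y)%N ->
    (if y == x then e x j.+1 * x%:R else phi j y) <= V x n j.+1 y * y%:R.
  elim: n j y => [|n IHn] j y y0.
    rewrite few_visits0 mul1r; case: eqP => [->|_].
      by rewrite ler_piMl//; have /andP[] := e01 j.+1.
    have /andP[ej0 ej1] := e01 j.
    rewrite /phi; case: ifP => _; first by rewrite ler_piMr.
    have : x%:R * e x j <= x%:R by rewrite ler_piMr.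
    lra.
  have nb z : phi j z <= V x n (j.+1 - (z == x))%N z * z%:R.
    have [->|z0] := posnP z; first by rewrite /phi leq0n !(mul0r, mulr0).
    case: (altP (z =P x)) => [->|zx].
      rewrite subn1 /= /phi leqnn mulrC.
      case: j => [|j]; first by rewrite /e expr0 subrr mul0r mulr_ge0// few_visits_ge0.
      by have := IHn j x x0; rewrite eqxx.
    by rewrite subn0; have := IHn j z z0; rewrite (negbTE zx).
  have yn0 : y%:R != 0 :> R by rewrite pnatr_eq0 -lt0n.
  have -> : V x n.+1 j.+1 y * y%:R = 2^-1 *
      (V x n (j.+1 - (y.+1 == x))%N y.+1 * y.+1%:R
       + V x n (j.+1 - (y.-1 == x))%N y.-1 * y.-1%:R).
    by rewrite few_visitsS; field.
  apply: (@le_trans _ _ (2^-1 * (phi j y.+1 + phi j y.-1))); last first.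
    by rewrite ler_wpM2l// lerD.
  case: (altP (y =P x)) => [->|yx]; first by rewrite phi_x mulKf.
  by rewrite -phi_harm// mulKf.
(* At x, [psi] takes the value seen from a neighbour, for which stepping onto x leaves k visits. By
   the induction hypothesis it agrees with [phi] k there, so [d] is harmonic off x and vanishes at 0
   and at x. *)
pose psi y : R := if y == x then L k x * x%:R else L k.+1 y * y%:R.
pose d y := psi y - phi k y.
have d_x : d x = 0.
  by rewrite /d /psi eqxx IH /phi leqnn mulrC subrr.
have d_0 : d 0%N = 0.
  by rewrite /d /psi /phi ltn_eqF// mulr0 mul0r subrr.
have psi_nb z : L (k.+1 - (z == x))%N z * z%:R = psi z.
  by rewrite /psi; case: eqP => [->|_]; rewrite ?subn1// subn0.
have d_harm y : (0 < y)%N -> y != x -> 2 * d y = d y.+1 + d y.-1.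
  move=> y0 yx; have := LE k.+1 y y0; rewrite !psi_nb => H.
  have E : L k.+1 y * y%:R = psi y by rewrite /psi (negbTE yx).
  by rewrite /d mulrBr phi_harm// -E H; ring.
have d_low y : (0 < y < x)%N -> d y = 0.
  move=> /andP[y0 yx].
  have A := @affine_from0 d x _ d_0.
  have {}A : forall y, (0 < y <= x)%N -> d y = d 1%N *+ y.
    by apply: A => z /andP[z0 zx]; rewrite d_harm// ltn_eqF.
  have := A x; rewrite x0 leqnn d_x => /(_ isT) /esym /eqP.
  rewrite mulrn_eq0 (gtn_eqF x0) /= => /eqP d1.
  by rewrite A ?y0 ?(ltnW yx)// d1 mul0rn.
have d_up y : (0 < y)%N -> d (x + y)%N = d x.+1 *+ y.
  move=> y0; have := @affine_from0 (fun z => d (x + z)%N) y.+1.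
  rewrite addn0 addn1 => -> //; last by rewrite y0 leqnSn.
  move=> z /andP[z0 _]; rewrite d_harm ?addnS//.
  - by case: z z0 => // z _; rewrite addnS.
  - by rewrite addn_gt0 x0.
  - by rewrite -{2}[x]addn0 eqn_add2l -lt0n.
have neq_xy y : (0 < y)%N -> (x + y == x)%N = false.
  by move=> y0; rewrite -[X in _ == X]addn0 eqn_add2l gtn_eqF.
(* To the right of x, [d] is linear with slope d (x + 1). The slope is nonnegative by [lower], and
   it cannot be positive because L <= 1 bounds [d] by x. *)
have d_xS : d x.+1 = 0.
  have dE y : (0 < y)%N -> d (x + y)%N = L k.+1 (x + y)%N * (x + y)%:R - phi k (x + y)%N.
    by move=> y0; rewrite /d /psi neq_xy.
  have d_ge0 : 0 <= d x.+1.
    rewrite -addn1 dE// subr_ge0.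
    have C : V x n k.+1 (x + 1)%N * (x + 1)%:R @[n --> \oo] --> L k.+1 (x + 1)%N * (x + 1)%:R.
      by apply: cvgM; [exact: VL|exact: cvg_cst].
    rewrite -(cvg_lim (@Rhausdorff R) C); apply: limr_ge.
      by apply/cvg_ex; eexists; exact: C.
    apply: nearW => n; have := lower n k (x + 1)%N.
    by rewrite neq_xy//; apply; rewrite addn1.
  have d_le y : (0 < y)%N -> d x.+1 *+ y <= x%:R.
    move=> y0; rewrite -d_up// dE// phi_up ?leq_addr// natrD.
    have /andP[ej0 _] := e01 k.
    have : L k.+1 (x + y)%N * (x%:R + y%:R) <= x%:R + y%:R.
      by rewrite ler_piMl// addr_ge0.
    have : 0 <= x%:R * e x k by rewrite mulr_ge0.
    lra.
  apply/eqP; rewrite eq_le d_ge0 andbT leNgt; apply/negP => dgt0.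
  have := d_le (Num.truncn (x%:R / d x.+1)).+1 (ltn0Sn _).
  rewrite leNgt => /negP; apply.
  by rewrite -[ltRHS]mulr_natr mulrC -ltr_pdivrMr// truncnS_gt.
have d_xP : d x.-1 = 0.
  have [->//|x1] := posnP x.-1.
  by apply: d_low; rewrite x1 prednK ?leqnn.
(* Averaging at x itself, where the kink of [phi] k lies, turns e x k into e x (k + 1). *)
have := LE k.+1 x x0; rewrite !psi_nb => H.
have E : psi x.+1 + psi x.-1 = 2 * (e x k.+1 * x%:R).
  by rewrite -phi_x -[psi x.+1](subrK (phi k x.+1)) -[psi x.-1](subrK (phi k x.-1))
    -/(d _) -/(d _) d_xS d_xP !add0r.
by move: H; rewrite E => /(mulfI (lt0r_neq0 (ltr0Sn _ 1))) /(mulIf xn0).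
Qed.

End few_visits.

(** * Finite windows of the two-sided walk *)

Definition future_idx (n : nat) : seq int := [seq i.+1%:Z | i <- iota 0 n].
Definition past_idx (n : nat) : seq int := [seq - i.+1%:Z | i <- iota 0 n].

(** A window takes countably many values, each on a finite intersection of cylinders, so an
    arbitrary predicate of it is measurable. *)
Lemma measurable_window (I : seq int) (P : seq int -> Prop) :
  measurable ([set w | P [seq w i | i <- I]] : set trajectory).
Proof.
have -> : [set w | P [seq w i | i <- I]] =
    \bigcup_l ([set w : trajectory | [seq w i | i <- I] = l] `&` [set _ | P l]).
  apply/seteqP; split=> [w Pw|w [l _ [/= <-//]]].
  by exists [seq w i | i <- I].
apply: countable_bigcupT_measurable => [|l]; first exact: countableP.
have [Pl|nPl] := pselect (P l); last first.
  rewrite (_ : _ `&` _ = set0); first exact: measurable0.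
  by apply/seteqP; split=> // w [].
rewrite (_ : [set _ | P l] = setT); last by apply/seteqP; split.
rewrite setIT; elim: I l {Pl} => [|i I IH] [|y l] /=.
- by rewrite (_ : [set _ | _] = setT)//; apply/seteqP; split.
- by rewrite (_ : [set _ | _] = set0)//; apply/seteqP; split.
- by rewrite (_ : [set _ | _] = set0)//; apply/seteqP; split.
rewrite (_ : [set _ | _] = [set w : trajectory | w i = y] `&`
    [set w : trajectory | [seq w j | j <- I] = l]); last first.
  by apply/seteqP; split=> w /= [-> ->].
apply: measurableI; last exact: IH.
by apply: sub_sigma_algebra; exists i, y.
Qed.

Lemma path_weightE {R : realType} (y : nat) (s : seq nat) :
  path_weight y s = \prod_(0 <= i < size s)
    conditioned_step (nth 0 (y :: s) i)%N%:Z (nth 0 (y :: s) i.+1)%N%:Z :> R.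
Proof.
elim: s y => [|z s IH] y; first by rewrite big_nil.
by rewrite [path_weight _ _]/= IH [size _]/= big_nat_recl.
Qed.

Lemma map_future_idxP (w : int -> int) (n : nat) (s : seq nat) : size s = n ->
  [seq w i | i <- future_idx n] = map Posz s <->
  forall i, (i < n)%N -> w i.+1%:Z = (nth 0%N s i)%:Z.
Proof.
move=> sn; split=> [E i ni|H].
  have := congr1 (fun l => nth 0 l i) E.
  rewrite (nth_map 0%N) ?sn// /future_idx -map_comp (nth_map 0%N) ?size_iota//.
  by rewrite nth_iota.
apply: (@eq_from_nth _ 0); first by rewrite !size_map size_iota.
rewrite !size_map size_iota => i ni.
rewrite [in RHS](nth_map 0%N) ?sn// /future_idx -map_comp (nth_map 0%N) ?size_iota//.
by rewrite nth_iota//= H.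
Qed.

Lemma map_past_idxP (w : int -> int) (n : nat) (s : seq nat) : size s = n ->
  [seq w i | i <- past_idx n] = map Posz s <->
  forall i, (i < n)%N -> w (- i.+1%:Z) = (nth 0%N s i)%:Z.
Proof.
move=> sn; have := map_future_idxP (fun k => w (- k)) sn.
by rewrite /future_idx /past_idx -!map_comp.
Qed.

Section two_sided_walk.
Context {R : realType} (Q : int -> probability trajectory R).
Hypothesis QP : two_sided_conditioned_walk Q.
Variables (x : nat) (x0 : (0 < x)%N).

Let cyl (n : nat) (u : seq nat * seq nat) : set trajectory :=
  [set w | [/\ w 0 = x%:Z, [seq w i | i <- future_idx n] = map Posz u.1
             & [seq w i | i <- past_idx n] = map Posz u.2]].

Let cyl_measurable n u : measurable (cyl n u).
Proof.
have := @measurable_window (0 :: future_idx n ++ past_idx n)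
  (fun l => l = x%:Z :: map Posz u.1 ++ map Posz u.2 /\ size u.1 = n).
(* The length of u.1 is what allows the concatenated window to be split; with a wrong length the
   cylinder is empty. *)
have [un|un] := eqVneq (size u.1) n; last first.
  move=> _; rewrite (_ : cyl _ _ = set0); first exact: measurable0.
  apply/seteqP; split=> // w [_ /(congr1 size)].
  by rewrite !size_map size_iota => /esym/eqP; rewrite (negbTE un).
congr measurable; apply/seteqP; split=> w /=; rewrite map_cat.
  move=> [[w0 /eqP]]; rewrite eqseq_cat ?size_map ?size_iota//.
  by move=> /andP[/eqP ? /eqP ?] _.
by move=> [w0 -> ->]; rewrite un; split=> //; congr cons.
Qed.

Let cyl_prob n u : size u.1 = n -> size u.2 = n ->
  Q x%:Z (cyl n u) = (path_weight x u.1 * path_weight x u.2)%:E.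
Proof.
move=> s1 s2.
(* [Negz] i is -(i + 1), so the past list is read without x in front, unlike the future one. *)
pose v (k : int) : int := match k with
  | Posz i => (nth 0%N (x :: u.1) i)%:Z
  | Negz i => (nth 0%N u.2 i)%:Z end.
have vN i : v (- i%:Z) = (nth 0%N (x :: u.2) i)%:Z.
  by case: i => [|i] //; rewrite -NegzE.
rewrite (_ : cyl n u = [set w : trajectory | forall k : int, (`|k| <= n)%N -> w k = v k]).
  rewrite QP; last by rewrite eqz_nat -lt0n.
  congr (_%:E); rewrite /v /= eqxx mul1r !path_weightE s1 s2; congr (_ * _).
  by apply: eq_bigr => i _; rewrite -!/(v _) !vN.
apply/seteqP; split=> w /=.
  move=> [w0 /(map_future_idxP _ s1) wf /(map_past_idxP _ s2) wp] [[|i]|i] //= ni.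
  - exact: wf.
  - by rewrite NegzE wp.
move=> H; split; first exact: (H 0).
- by apply/(map_future_idxP _ s1) => i ni; rewrite H.
- by apply/(map_past_idxP _ s2) => i ni; rewrite H ?vN// abszN.
Qed.

Let pairs n := [seq (s, s') | s <- nn_paths n x, s' <- nn_paths n x].

(** Cylinders over nearest-neighbour paths are disjoint and lie in the event; the other windows are
    simply dropped, hence only an inequality. *)
Let window_ge n (P : seq int -> seq int -> bool) :
  ((\sum_(s <- nn_paths n x) \sum_(s' <- nn_paths n x)
    path_weight x s * path_weight x s' * (P (map Posz s) (map Posz s'))%:R)%:E <=
  Q x%:Z [set w | P [seq w i | i <- future_idx n] [seq w i | i <- past_idx n]])%E.
Proof.
pose r := [seq u <- pairs n | P (map Posz u.1) (map Posz u.2)].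
have ur : uniq r.
  by rewrite filter_uniq// allpairs_uniq ?uniq_nn_paths// => -[? ?] [? ?].
have rP u : u \in r -> size u.1 = n /\ size u.2 = n /\ P (map Posz u.1) (map Posz u.2).
  rewrite mem_filter => /andP[Pu /allpairsP[[s s'] [/= H1 H2 E]]].
  by move: Pu; rewrite E /= (size_nn_paths H1) (size_nn_paths H2).
have Pinj : injective Posz by move=> a b [].
have tr : trivIset [set` r] (cyl n).
  apply/trivIsetP => -[s1 s2] [s3 s4] _ _ neq; apply/seteqP; split=> // w.
  move=> [[_ + +] [_ + +]] /= => -> -> /(inj_map Pinj)/= E1.
  by move=> /(inj_map Pinj)/= E2; rewrite E1 E2 eqxx in neq.
have mE : measurable ([set w | P [seq w i | i <- future_idx n]
    [seq w i | i <- past_idx n]] : set trajectory).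
  have := @measurable_window (future_idx n ++ past_idx n)
    (fun l => P (take n l) (drop n l)).
  congr measurable; apply/seteqP; split=> w /=; rewrite map_cat;
    by rewrite take_size_cat ?drop_size_cat// !size_map size_iota.
have mC : forall u, [set` r] u -> measurable (cyl n u) by move=> u _; exact: cyl_measurable.
have <- : Q x%:Z (\bigcup_(u in [set` r]) cyl n u) = (\sum_(s <- nn_paths n x) \sum_(s' <- nn_paths n x)
    path_weight x s * path_weight x s' * (P (map Posz s) (map Posz s'))%:R)%:E.
  rewrite (measure_fin_bigcup (Q x%:Z) (finite_seq r) tr mC) -fsbig_seq//.
  rewrite (eq_big_seq (fun u => (path_weight x u.1 * path_weight x u.2)%:E)); last first.
    by move=> u /rP[H1 [H2 _]]; exact: cyl_prob.
  rewrite sumEFin; congr (_%:E).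
  rewrite /r big_filter big_mkcond /pairs big_allpairs /=.
  apply: eq_bigr => s _; apply: eq_bigr => s' _.
  by case: ifP => _; rewrite ?mulr1 ?mulr0.
apply: le_measure; rewrite ?inE//; first exact: (fin_bigcup_measurable (finite_seq r) mC).
move=> w [u /= /rP[_ [_ Pu]] [_ H1 H2]].
by rewrite /= H1 H2.
Qed.

Let weight_total n : \sum_(s <- nn_paths n x) path_weight x s = 1 :> R.
Proof.
rewrite -(few_visits_total x x0 (ltnSn n)) /few_visits.
rewrite big_seq [RHS]big_seq; apply: eq_bigr => s /size_nn_paths sn.
by rewrite ltnS -sn count_size mulr1.
Qed.

(** The lower bounds for the event and for its complement already add up to 1, the total path
    weight, so both are equalities. *)
Lemma window_prob n (P : seq int -> seq int -> bool) :
  Q x%:Z [set w | P [seq w i | i <- future_idx n] [seq w i | i <- past_idx n]] =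
  (\sum_(s <- nn_paths n x) \sum_(s' <- nn_paths n x)
    path_weight x s * path_weight x s' * (P (map Posz s) (map Posz s'))%:R)%:E.
Proof.
set E := (X in Q _ X); set S := (X in _ = X%:E).
have mE : measurable (E : set trajectory).
  have := @measurable_window (future_idx n ++ past_idx n)
    (fun l => P (take n l) (drop n l)).
  congr measurable; apply/seteqP; split=> w; rewrite /E /= map_cat;
    by rewrite take_size_cat ?drop_size_cat// !size_map size_iota.
have := @window_ge n P; rewrite -/E -/S => ge1.
have := @window_ge n (fun l l' => ~~ P l l').
rewrite (_ : [set w | _] = ~` E); last first.
  by apply/seteqP; split=> w; rewrite /E /= => /negP.
set S' := (X in (X%:E <= _)%E) => ge2.
have SS : S + S' = 1.
  rewrite /S /S' -big_split /= -[RHS](mulr1 1) -[X in _ = X * _](weight_total n) mulr_suml.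
  apply: eq_bigr => s _; rewrite -big_split /= -[X in _ = _ * X](weight_total n) mulr_sumr.
  apply: eq_bigr => s' _; rewrite -mulrDr.
  by case: (P _ _); rewrite /= ?addr0 ?add0r mulr1.
have QC : Q x%:Z (~` E) = (1 - Q x%:Z E)%E by rewrite probability_setC.
have fE : Q x%:Z E \is a fin_num by rewrite fin_num_measure.
apply/eqP; rewrite eq_le ge1 andbT.
move: ge2 ge1; rewrite QC -(fineK fE) -EFinB !lee_fin; lra.
Qed.

Let p : R := (2 * x%:R)^-1.

(** Past and future are independent given the starting point, and avoiding x in the past means fewer
    than 1 visit, whence the second factor with k = 1. *)
Lemma few_visits_prob n k :
  Q x%:Z [set w | (count_mem x%:Z [seq w i | i <- future_idx n] < k)%N &&
    (x%:Z \notin [seq w i | i <- past_idx n])] =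
  (few_visits x n k x * few_visits x n 1 x)%:E.
Proof.
rewrite (window_prob n (fun l l' => (count_mem x%:Z l < k)%N && (x%:Z \notin l'))).
congr (_%:E); rewrite /few_visits mulr_suml.
have Pinj : injective Posz by move=> a b [].
apply: eq_bigr => s _; rewrite mulr_sumr; apply: eq_bigr => s' _.
rewrite (mem_map Pinj) -has_pred1 has_count -eqn0Ngt ltnS leqn0.
have -> : count_mem x%:Z (map Posz s) = count_mem x s.
  by rewrite count_map; apply: eq_count => z /=; rewrite eqz_nat.
rewrite mulrACA -natrM mulnb //.
Qed.

Lemma start_prob : Q x%:Z [set w | w 0 = x%:Z] = 1%E.
Proof.
have := @cyl_prob 0 ([::], [::]) erefl erefl; rewrite /= mulr1 => <-.
by congr (Q _ _); apply/seteqP; split=> w /=; [by move=> w0; split|by case].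
Qed.

Lemma measurable_few_visits k : measurable
  ([set w | forall n, (count_mem x%:Z [seq w i | i <- future_idx n] < k)%N]
   : set trajectory).
Proof.
rewrite (_ : [set w | _] = \bigcap_n
   [set w : trajectory | (count_mem x%:Z [seq w i | i <- future_idx n] < k)%N]).
  apply: bigcapT_measurable => n.
  exact: (@measurable_window (future_idx n) (fun l => (count_mem x%:Z l < k)%N)).
by apply/seteqP; split=> w /= H n => [_|]; exact: H.
Qed.

Lemma avoids_before0E (w : int -> int) : avoids_before0 [set x%:Z] w <->
  forall n, x%:Z \notin [seq w i | i <- past_idx n].
Proof.
split=> [H n|H [//|k] _ /= wx].
  by apply/mapP => -[k /mapP[i _ ->] /esym]; apply: H; rewrite oppr_lt0.
have /mapP := H k.+1; apply; exists (Negz k) => //.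
by rewrite NegzE; apply: (map_f (fun i : nat => - i.+1%:Z)); rewrite mem_iota leqnn.
Qed.

Lemma measurable_avoids_before0 :
  measurable (avoids_before0 [set x%:Z] : set trajectory).
Proof.
rewrite (_ : avoids_before0 _ = \bigcap_n
   [set w : trajectory | x%:Z \notin [seq w i | i <- past_idx n]]).
  apply: bigcapT_measurable => n.
  exact: (@measurable_window (past_idx n) (fun l => x%:Z \notin l)).
apply/seteqP; split=> w; first by move=> /avoids_before0E H n _; exact: H.
by move=> H; apply/avoids_before0E => n; exact: H.
Qed.

Let iotaS a n : iota a n.+1 = iota a n ++ [:: (a + n)%N].
Proof. by rewrite -addn1 iotaD. Qed.

Lemma avoids_few_visits_prob k :
  Q x%:Z ([set w | forall n, (count_mem x%:Z [seq w i | i <- future_idx n] < k)%N]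
    `&` avoids_before0 [set x%:Z]) = (p * (1 - (1 - p) ^+ k))%:E.
Proof.
pose F n : set trajectory := [set w |
  (count_mem x%:Z [seq w i | i <- future_idx n] < k)%N &&
    (x%:Z \notin [seq w i | i <- past_idx n])].
have mF n : measurable (F n).
  have := @measurable_window (future_idx n ++ past_idx n)
    (fun l => (count_mem x%:Z (take n l) < k)%N && (x%:Z \notin drop n l)).
  congr measurable; apply/seteqP; split=> w; rewrite /F /= map_cat;
    by rewrite take_size_cat ?drop_size_cat// !size_map size_iota.
have capF : \bigcap_n F n = [set w | forall n,
    (count_mem x%:Z [seq w i | i <- future_idx n] < k)%N] `&` avoids_before0 [set x%:Z].
  apply/seteqP; split=> w.
    move=> H; split=> [n|]; first by have /andP[] := H n I.
    by apply/avoids_before0E => n; have /andP[] := H n I.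
  by move=> [H1 /avoids_before0E H2] n _; rewrite /F /= H1 H2.
have H1 : (Q x%:Z \o F) n @[n --> \oo] --> Q x%:Z (\bigcap_n F n).
  apply: nonincreasing_cvg_mu => //.
  - by rewrite (le_lt_trans (probability_le1 _ _))// ltry.
  - exact: bigcapT_measurable.
  apply/nonincreasing_seqP => n; apply/subsetPset => w.
  rewrite /F /future_idx /past_idx !iotaS /= !map_cat count_cat mem_cat negb_or.
  by move=> /andP[/(leq_ltn_trans (leq_addr _ _)) -> /andP[->]].
have H2 : (Q x%:Z \o F) n @[n --> \oo] --> (p * (1 - (1 - p) ^+ k))%:E.
  have -> : Q x%:Z \o F = EFin \o (fun n => few_visits x n k x * few_visits x n 1 x).
    by apply/funext => n; rewrite /= few_visits_prob.
  apply: cvg_EFin; first exact: nearW.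
  rewrite mulrC; apply: cvgM; first exact: cvg_few_visits.
  have := @cvg_few_visits R x 1 x0.
  by rewrite expr1 opprB addrC subrK.
by rewrite -capF; exact: cvg_unique H1 H2.
Qed.

Lemma avoids_prob : Q x%:Z (avoids_before0 [set x%:Z]) = p%:E.
Proof.
pose F n : set trajectory := [set w | x%:Z \notin [seq w i | i <- past_idx n]].
have mF n : measurable (F n).
  exact: (@measurable_window (past_idx n) (fun l => x%:Z \notin l)).
have capF : \bigcap_n F n = avoids_before0 [set x%:Z].
  apply/seteqP; split=> w; first by move=> H; apply/avoids_before0E => n; exact: H.
  by move=> /avoids_before0E H n _; exact: H.
have H1 : (Q x%:Z \o F) n @[n --> \oo] --> Q x%:Z (\bigcap_n F n).
  apply: nonincreasing_cvg_mu => //.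
  - by rewrite (le_lt_trans (probability_le1 _ _))// ltry.
  - exact: bigcapT_measurable.
  apply/nonincreasing_seqP => n; apply/subsetPset => w.
  by rewrite /F /past_idx !iotaS /= !map_cat mem_cat negb_or => /andP[].
have H2 : (Q x%:Z \o F) n @[n --> \oo] --> p%:E.
  have -> : Q x%:Z \o F = EFin \o (fun n => few_visits x n 1 x).
    apply/funext => n /=; rewrite -[RHS]/((few_visits x n 1 x)%:E).
    (* The future is left free by asking for fewer than n + 1 visits in n steps. *)
    rewrite -[few_visits x n 1 x]mul1r -(few_visits_total x x0 (ltnSn n)).
    rewrite -few_visits_prob; congr (Q _ _); apply/seteqP; split=> w; rewrite /F /=.
      move=> ->; rewrite andbT ltnS (leq_trans (count_size _ _))//.
      by rewrite !size_map size_iota.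
    by case/andP.
  apply: cvg_EFin; first exact: nearW.
  have := @cvg_few_visits R x 1 x0.
  by rewrite expr1 opprB addrC subrK.
by rewrite -capF; exact: cvg_unique H1 H2.
Qed.

End two_sided_walk.

(** * Numbers of visits and the intensity *)

(** Bounds on a possibly infinite count become bounds on finite lists, to which windows and shifts
    apply directly. *)
Lemma counting_leP {T : choiceType} {R : realType} (A : set T) (m : nat) :
  (counting A <= m%:R%:E :> \bar R)%E <->
  forall s : seq T, uniq s -> {in s, forall i, A i} -> (size s <= m)%N.
Proof.
rewrite /counting; case: ifPn => /asboolP finA; last first.
  split=> [|H]; first by rewrite leye_eq.
  have [B BA mB] := infinite_set_fset m.+1 finA.
  have BA' : {in finmap.enum_fset B, forall i, A i} by move=> i; exact: BA.
  by have := leq_trans mB (H _ (finmap.fset_uniq B) BA'); rewrite ltnn.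
rewrite lee_fin ler_nat; split=> [Am s us sA|H].
  apply: leq_trans Am; apply: uniq_leq_size us _ => i /sA Ai.
  by rewrite in_fset_set// inE.
apply: H; first exact: finmap.fset_uniq.
by move=> i; rewrite in_fset_set// inE.
Qed.

Lemma probability_setI1 d (T : measurableType d) (R : realType)
    (P : probability T R) (A S : set T) :
  measurable A -> measurable S -> P S = 1%E -> P (A `&` S) = P A.
Proof.
move=> mA mS PS; suff PAS : P (A `\` S) = 0%E.
  by rewrite [RHS](measureDI P mA mS) [X in _ = (X + _)%E]PAS add0e.
apply/eqP; rewrite eq_le measure_ge0 andbT.
have <- : P (~` S) = 0%E by rewrite probability_setC// PS subee.
apply: le_measure; last by move=> w [].
- by rewrite inE; exact: measurableD.
- by rewrite inE; exact: measurableC.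
Qed.

Definition window_idx (n : nat) : seq int := 0 :: future_idx n ++ past_idx n.

Lemma mem_window_idx (n : nat) (i : int) : (i \in window_idx n) = (`|i| <= n)%N.
Proof.
rewrite /window_idx in_cons mem_cat; apply/idP/idP.
  case/orP=> [/eqP->//|]. case/orP=> /mapP[k]; rewrite mem_iota add0n /= => kn ->.
    by [].
  by rewrite abszN.
case: i => [[|i]|i] //= ni; apply/orP.
  left; apply/mapP; exists i => //; by rewrite mem_iota.
by right; apply/mapP; exists i; rewrite ?mem_iota// NegzE.
Qed.

Lemma uniq_window_idx n : uniq (window_idx n).
Proof.
rewrite /window_idx cons_uniq mem_cat cat_uniq !map_inj_uniq ?iota_uniq; last 2 first.
- by move=> i j /oppr_inj [].
- by move=> i j [].
rewrite andbT negb_or; apply/andP; split.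
  by apply/andP; split; apply/mapP => -[].
by apply/hasPn => _ /mapP[i _ ->]; apply/mapP => -[].
Qed.

Lemma visits_leP {R : realType} (x : int) (w : int -> int) (m : nat) :
  (visits x w <= m%:R%:E :> \bar R)%E <->
  forall n, (count_mem x [seq w i | i <- window_idx n] <= m)%N.
Proof.
rewrite counting_leP; split=> [H n|H s us sA].
  rewrite count_map -size_filter; apply: H; first exact/filter_uniq/uniq_window_idx.
  by move=> i; rewrite mem_filter => /andP[/eqP].
apply: leq_trans (H (\max_(i <- s) `|i|%N)); rewrite count_map -size_filter.
apply: uniq_leq_size us _ => i si; rewrite mem_filter /= (sA i si) eqxx /=.
by rewrite mem_window_idx leq_bigmax_seq.
Qed.

Definition visits_at_most {R : realType} (x : int) (m : nat) : set trajectory_mod_shift :=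
  [set w | (visits x w <= m%:R%:E :> \bar R)%E].

Section visits.
Context {R : realType}.

Lemma visits_shift_le (x k : int) (w : int -> int) m :
  (visits x (shift_trajectory k w) <= m%:R%:E :> \bar R)%E ->
  (visits x w <= m%:R%:E :> \bar R)%E.
Proof.
rewrite !counting_leP => H s us sA.
rewrite -(size_map (fun i => i - k)); apply: H.
  by rewrite map_inj_uniq//; exact: addIr.
by move=> _ /mapP[i /sA + ->]; rewrite /= /shift_trajectory subrK.
Qed.

Lemma measurable_visits_at_most (x : int) m :
  measurable (@visits_at_most R x m : set trajectory).
Proof.
rewrite (_ : visits_at_most _ _ = \bigcap_n
   [set w : trajectory | (count_mem x [seq w i | i <- window_idx n] <= m)%N]).
  apply: bigcapT_measurable => n.
  exact: (@measurable_window (window_idx n) (fun l => (count_mem x l <= m)%N)).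
apply/seteqP; split=> w; first by move=> /visits_leP H n _; exact: H.
by move=> H; apply/visits_leP => n; exact: H.
Qed.

Lemma measurable_mod_visits_at_most (x : int) m : measurable (@visits_at_most R x m).
Proof.
split; first exact: measurable_visits_at_most.
move=> k w; split; first exact: visits_shift_le.
move=> H; apply: (@visits_shift_le _ (- k)); rewrite /shift_trajectory.
by rewrite (_ : (fun _ => _) = w)//; apply/funext => n; rewrite -addrA addNr addr0.
Qed.

Lemma visits_natP (x : int) (w : int -> int) :
  visits x w = +oo%E :> \bar R \/ exists m : nat, visits x w = m%:R%:E :> \bar R.
Proof.
by rewrite /visits /counting; case: ifP => _; [right; eexists|left].
Qed.

Lemma measurable_visits (x : int) :
  measurable_fun setT (@visits R x : trajectory_mod_shift -> \bar R).
Proof.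
apply: (measurability _ (ErealGenOInfty.measurableE R)) => _ [_ [y ->] <-].
rewrite setTI; have [y0|y0] := ltP y 0.
  rewrite (_ : _ @^-1` _ = setT)//; apply/seteqP; split=> // w _ /=.
  rewrite in_itv /= andbT; have [->|[m ->]] := visits_natP x w; first by rewrite ltry.
  by rewrite lte_fin (lt_le_trans y0).
rewrite (_ : _ @^-1` _ = ~` @visits_at_most R x (Num.truncn y)).
  by apply: measurableC; exact: measurable_mod_visits_at_most.
apply/seteqP; split=> w; rewrite /visits_at_most /= in_itv /= andbT.
  have [->|[m ->]] := visits_natP x w; first by rewrite leye_eq.
  rewrite lte_fin lee_fin ler_nat => ym; apply/negP; rewrite -ltnNge.
  by rewrite -(ltr_nat R) (le_lt_trans _ ym)// truncn_le.
have [->|[m ->]] := visits_natP x w; first by rewrite ltry.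
rewrite lte_fin lee_fin ler_nat => /negP; rewrite -ltnNge => ym.
by rewrite (lt_le_trans (truncnS_gt _))// ler_nat.
Qed.

Lemma hits1P (x : int) (w : int -> int) :
  hits [set x] w <-> ~ (visits x w <= 0%:R%:E :> \bar R)%E.
Proof.
rewrite counting_leP; split=> [[n /= wn] H|H].
  have nA : {in [:: n], forall i, [set i | w i = x] i}.
    by move=> i; rewrite inE => /eqP->.
  by have := H [:: n] isT nA.
apply: contrapT => nh; apply: H => -[//|n s] _ /(_ n (mem_head _ _)) /= wn.
by exfalso; apply: nh; exists n.
Qed.

End visits.

Section intensity.
Context {R : realType} (Q : int -> probability trajectory R)
  (nu : {measure set trajectory_mod_shift -> \bar R}).
Hypothesis QP : two_sided_conditioned_walk Q.
Hypothesis nuP : interlacement_intensity Q nu.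
Variables (x : nat) (x0 : (0 < x)%N).
Let p : R := (2 * x%:R)^-1.

(** The walk is at x at time 0 and never before, so at most k visits in all means fewer than k
    returns afterwards. *)
Lemma avoids_visits_at_most_prob k :
  Q x%:Z (@visits_at_most R x%:Z k `&` avoids_before0 [set x%:Z]) =
  (p * (1 - (1 - p) ^+ k))%:E.
Proof.
pose S : set trajectory := [set w | w 0 = x%:Z].
have mS : measurable S.
  have := @measurable_window [:: 0] (fun l => l = [:: x%:Z]).
  by congr measurable; apply/seteqP; split=> w /=; [case|move=> wx; congr cons].
have mav := measurable_avoids_before0 x.
have mfew := measurable_few_visits x k.
rewrite -(avoids_few_visits_prob QP x0 k).
rewrite -(@probability_setI1 _ _ _ (Q x%:Z) _ S) ?(start_prob QP x0)//; last first.
  by apply: measurableI => //; exact: measurable_visits_at_most.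
rewrite -(@probability_setI1 _ _ _ (Q x%:Z) (_ `&` avoids_before0 _) S) ?(start_prob QP x0)//; last first.
  exact: measurableI.
congr (Q _ _); apply/seteqP; split=> w [[H /[dup] aw /avoids_before0E av] wx].
  split=> //; split=> // n; have := (visits_leP _ _ _).1 H n.
  by rewrite /= wx eqxx map_cat count_cat; apply: leq_trans; rewrite leq_addr.
split=> //; split=> //; apply/visits_leP => n.
rewrite /= wx eqxx map_cat count_cat.
have -> : count_mem x%:Z [seq w i | i <- past_idx n] = 0%N by exact/count_memPn.
by rewrite addn0; exact: H.
Qed.

(** Having more than k >= 0 visits forces a hit, so the intensity formula with K = {x} applies. At k
    = 0 the mass is x/2, the rate of trajectories hitting x at level 1; the factor (1 - p)^k is the
    geometric tail. *)
Lemma intensity_many_visits k :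
  nu (~` @visits_at_most R x%:Z k) = (x%:R ^+ 2 * p * (1 - p) ^+ k)%:E.
Proof.
have hK : (~` @visits_at_most R x%:Z k) `&` hits [set x%:Z] = ~` @visits_at_most R x%:Z k.
  apply/seteqP; split=> [w []//|w H]; split=> //; apply/(@hits1P R) => H0; apply: H.
  by apply: le_trans H0 _; rewrite lee_fin ler_nat.
have mV := measurable_mod_visits_at_most (R := R) x%:Z k.
rewrite -hK nuP; [|exact: finite_set1|exact: measurableC].
rewrite /entrance_measure fsbig_set1 natrX /=.
have mV' : measurable (@visits_at_most R x%:Z k : set trajectory).
  exact: measurable_visits_at_most.
have mav := measurable_avoids_before0 x.
rewrite setIC -setDE measureD//; last first.
  by rewrite (le_lt_trans (probability_le1 _ _)) ?ltry.
rewrite [X in (_ - X)%E](_ : _ = (p * (1 - (1 - p) ^+ k))%:E); last first.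
  by rewrite setIC; exact: avoids_visits_at_most_prob.
rewrite [X in (X - _)%E](avoids_prob QP x0) -EFinB -EFinM.
by congr (_%:E); rewrite -/p; ring.
Qed.

End intensity.

(** * Generating functions of compound Poisson laws *)

(* The j-th factor is the generating function of (j + 1) N for N Poisson with
   rate lam j, without its normalization and truncated after the M-th term; the
   product then agrees below degree M with the unnormalized generating function
   of the compound Poisson law. *)
Definition poisson_factor {R : realType} (lam : nat -> R) (M j : nat) : {poly R} :=
  \sum_(k < M.+1) (lam j ^+ k / k`!%:R) *: 'X^(j.+1 * k).

Definition compound_poisson_poly {R : realType} (lam : nat -> R) (M : nat) : {poly R} :=
  \prod_(j < M) poisson_factor lam M j.

Section compound_poisson_poly.
Context {R : realType} (lam : nat -> R) (M : nat).

Let scaleXM (a b : R) (n m : nat) :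
  (a *: 'X^n) * (b *: 'X^m) = (a * b) *: 'X^(n + m) :> {poly R}.
Proof. by rewrite -!mul_polyC mulrACA -polyCM -exprD. Qed.

Lemma coef_compound_poisson_poly m : (compound_poisson_poly lam M)`_m =
  \sum_(k : {ffun 'I_M -> 'I_M.+1} | (\sum_(j < M) j.+1 * k j)%N == m)
    \prod_(j < M) (lam j ^+ k j / (k j)`!%:R).
Proof.
rewrite /compound_poisson_poly /poisson_factor bigA_distr_bigA /= coef_sum.
rewrite [RHS]big_mkcond; apply: eq_bigr => k _.
have -> : \prod_(j < M) ((lam j ^+ k j / (k j)`!%:R) *: 'X^(j.+1 * k j)) =
    (\prod_(j < M) (lam j ^+ k j / (k j)`!%:R)) *: 'X^(\sum_(j < M) j.+1 * k j)%N.
  elim/big_rec3 : _ => [|j a b c _ ->]; first by rewrite scale1r.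
  by rewrite scaleXM.
by rewrite coefZ coefXn eq_sym; case: eqP => _; rewrite ?mulr1 ?mulr0.
Qed.

(** The derivative of a truncated exponential lacks only the last term, here of degree j + (j + 1) M
    >= M, hence a multiple of 'X^M. *)
Lemma deriv_poisson_factor j : exists S, deriv (poisson_factor lam M j) =
  (j.+1%:R * lam j) *: 'X^j * poisson_factor lam M j + 'X^M * S.
Proof.
exists (- (j.+1%:R * lam j * (lam j ^+ M / M`!%:R)) *: 'X^(j + j * M)).
rewrite /poisson_factor (raddf_sum (@deriv R)) big_ord_recl /= muln0 expr0.
rewrite derivZ derivC scaler0 add0r [in RHS]big_ord_recr /= mulrDr -addrA.
have -> : (j.+1%:R * lam j) *: 'X^j * (lam j ^+ M / M`!%:R *: 'X^(j.+1 * M))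
    + 'X^M * (- (j.+1%:R * lam j * (lam j ^+ M / M`!%:R)) *: 'X^(j + j * M)) = 0 :> {poly R}.
  have E : (M + (j + j * M) = j + j.+1 * M)%N by rewrite mulSn addnCA.
  by rewrite -['X^M]scale1r !scaleXM mul1r E -scalerDl subrr scale0r.
rewrite addr0 mulr_sumr; apply: eq_bigr => k _.
rewrite /bump leq0n add1n derivZ derivXn -[X in _ *: X]scaler_nat scalerA scaleXM.
have -> : (j.+1 * k.+1).-1 = (j + j.+1 * k)%N by rewrite mulnS.
congr (_ *: _); rewrite factS !natrM exprS; field.
by rewrite nat1r !pnatr_eq0 -lt0n fact_gt0.
Qed.

(** Logarithmic derivatives add up over a product, and the multiples of 'X^M are carried along. *)
Lemma deriv_compound_poisson_poly : exists S, deriv (compound_poisson_poly lam M) =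
  (\sum_(j < M) (j.+1%:R * lam j) *: 'X^j) * compound_poisson_poly lam M + 'X^M * S.
Proof.
rewrite /compound_poisson_poly.
elim/big_ind2 : _ => [|A a B b [S HS] [T HT]|j _]; last exact: deriv_poisson_factor.
  by exists 0; rewrite derivC mul0r mulr0 addr0.
exists (S * b + a * T); rewrite derivM HS HT; ring.
Qed.

(** The sum of (j + 1) c (r X)^j is c/(1 - r X)^2 up to powers X^M and above, which do not affect
    the coefficient m < M. Clearing the denominator and comparing coefficients gives the
    recursion. *)
Lemma compound_geometric_recursion (c r : R) : (forall j, lam j = c * r ^+ j) ->
  forall m, (m < M)%N ->
  m.+1%:R * (compound_poisson_poly lam M)`_m.+1 =
    2 * r * (m%:R * (compound_poisson_poly lam M)`_m)
    - r ^+ 2 * (m.-1%:R * (compound_poisson_poly lam M)`_m.-1)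
    + c * (compound_poisson_poly lam M)`_m.
Proof.
move=> lamE m mM; set C := compound_poisson_poly lam M.
have [S HS] := deriv_compound_poisson_poly.
pose Y : {poly R} := r%:P * 'X.
have YX n : Y ^+ n = (r ^+ n)%:P * 'X^n by rewrite /Y exprMn polyC_exp.
have geom n : (1 - Y) ^+ 2 * (\sum_(j < n) j.+1%:R * Y ^+ j) =
    1 - n.+1%:R * Y ^+ n + n%:R * Y ^+ n.+1 :> {poly R}.
  elim: n => [|n IH]; first by rewrite big_ord0; ring.
  by rewrite big_ord_recr /= mulrDr IH !exprS -[n.+2%:R]natr1 -[n.+1%:R]natr1; ring.
have [T HT] : exists T, (1 - Y) ^+ 2 * deriv C = c%:P * C + 'X^M * T.
  rewrite HS.
  have -> : \sum_(j < M) (j.+1%:R * lam j) *: 'X^j =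
      c%:P * \sum_(j < M) j.+1%:R * Y ^+ j :> {poly R}.
    rewrite mulr_sumr; apply: eq_bigr => j _.
    by rewrite YX lamE -mul_polyC !polyCM polyC_natr; ring.
  exists (c%:P * (- M.+1%:R * (r ^+ M)%:P + M%:R * (r ^+ M)%:P * Y) * C + (1 - Y) ^+ 2 * S).
  rewrite mulrDr mulrA [(1 - Y) ^+ 2 * _]mulrCA geom [Y ^+ M.+1]exprS YX. rewrite -/C; ring.
have := congr1 (fun u : {poly R} => u`_m) HT.
rewrite coefD coefCM coefXnM mM addr0.
have -> : (1 - Y) ^+ 2 * deriv C = deriv C - (2 * r)%:P * ('X * deriv C)
    + (r ^+ 2)%:P * ('X * ('X * deriv C)).
  by rewrite polyCM polyC_natr polyC_exp /Y; ring.
have dC i : (deriv C)`_i = i.+1%:R * C`_i.+1 by rewrite coef_deriv mulr_natl.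
rewrite coefD coefB !coefCM !coefXM !dC => <-.
by case: m {mM} => [|[|m]] /=; ring.
Qed.

End compound_poisson_poly.

(** * The law of the local time *)

Lemma poisson_prob_set1 {R : realType} (rate : R) (k : nat) : 0 < rate ->
  poisson_prob rate 0%N [set k] = (rate ^+ k / k`!%:R * expR (- rate))%:E.
Proof.
move=> r0; rewrite /poisson_prob r0 esum_set1 ?lee_fin ?poisson_pmf_ge0//.
by rewrite /poisson_pmf r0.
Qed.

Lemma counting_natP {T : choiceType} {R : realType} (A : set T) :
  counting A = +oo%E :> \bar R \/ exists m : nat, counting A = m%:R%:E :> \bar R.
Proof. by rewrite /counting; case: ifP => _; [right; eexists|left]. Qed.

Lemma counting_ge0 {T : choiceType} {R : realType} (A : set T) :
  (0 <= counting A :> \bar R)%E.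
Proof. by have [->|[m ->]] := @counting_natP T R A; rewrite ?lee_fin. Qed.

Lemma counting_eq0 {T : choiceType} {R : realType} (A : set T) :
  counting A = 0%:R%:E :> \bar R <-> A = set0.
Proof.
split=> [A0|->]; last by rewrite /counting asboolT ?fset_set0.
apply/seteqP; split=> // i Ai.
have /counting_leP : (counting A <= 0%:R%:E :> \bar R)%E by rewrite A0.
have iA : {in [:: i], forall j, A j} by move=> j; rewrite inE => /eqP->.
by move=> /(_ [:: i] isT iA).
Qed.

Section count_visits.
Context {R : realType} (x : int).
Local Notation at_most := (@visits_at_most R x).

(** Level k is k + 1 visits: trajectories missing x contribute nothing to the local time. *)
Definition visits_level (k : nat) : set trajectory_mod_shift :=
  at_most k.+1 `\` at_most k.

Lemma visits_levelP k w : visits_level k w <-> visits x w = k.+1%:R%:E :> \bar R.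
Proof.
rewrite /visits_level /visits_at_most /=; split.
  move=> [+ +]; have [->|[m ->]] := @visits_natP R x w; first by rewrite leye_eq.
  rewrite !lee_fin !ler_nat => mk /negP; rewrite -ltnNge => km.
  by congr (_%:R%:E); apply/eqP; rewrite eqn_leq mk.
by move=> ->; rewrite !lee_fin !ler_nat ltnn.
Qed.

Lemma measurable_visits_level k : measurable (visits_level k).
Proof. by apply: measurableD; exact: measurable_mod_visits_at_most. Qed.

Lemma visits_sum_level (M : nat) (w : trajectory_mod_shift) : at_most M w ->
  visits x w = (\sum_(j < M) j.+1%:R%:E * (\1_(visits_level j) w)%:E)%E :> \bar R.
Proof.
rewrite /visits_at_most /=; have [->|[m wm]] := @visits_natP R x w.
  by rewrite leye_eq.
rewrite wm lee_fin ler_nat => mM.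
have ind j : (\1_(visits_level j) w)%:E = ((m == j.+1)%:R)%:E :> \bar R.
  rewrite indicE; congr (nat_of_bool _)%:R%:E; apply/idP/eqP => [|mj].
    rewrite inE => /visits_levelP; rewrite wm => /eqP.
    by rewrite eqe eqr_nat => /eqP.
  by rewrite inE; apply/visits_levelP; rewrite wm mj.
under eq_bigr do rewrite ind -EFinM.
rewrite sumEFin; congr (_%:E).
case: m {wm ind} mM => [|m] mM; first by rewrite big1// => j _; rewrite mulr0.
rewrite (bigD1 (Ordinal mM))//= eqxx mulr1 big1 ?addr0// => j jm.
have /negbTE-> : m.+1 != j.+1; last by rewrite mulr0.
by apply: contra jm => /eqP[mj]; apply/eqP/val_inj.
Qed.

Lemma sum_visits_level (w : nat -> trajectory_mod_shift) (M : nat) :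
  (forall i, at_most M (w i)) ->
  (\sum_(i <oo) visits x (w i) = \sum_(j < M) j.+1%:R%:E *
     counting [set i | visits_level j (w i)] :> \bar R)%E.
Proof.
move=> wM; under eq_eseriesr do rewrite (visits_sum_level (wM _)).
rewrite nneseries_sum; last by move=> *; rewrite mule_ge0// lee_fin.
apply: eq_bigr => j _.
rewrite nneseriesZl//.
by rewrite counting_dirac.
Qed.

End count_visits.

Section local_time_law.
Context {R : realType} d (Omega : measurableType d) (P : probability Omega R).
Variables (alpha : R) (alpha0 : 0 < alpha) (W : nat -> Omega -> trajectory_mod_shift).
Variables (Q : int -> probability trajectory R)
  (nu : {measure set trajectory_mod_shift -> \bar R}).
Hypotheses (QP : two_sided_conditioned_walk Q) (nuP : interlacement_intensity Q nu).
Hypothesis WP : poisson_process P (fun A => alpha%:E * nu A)%E W.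

Let mW i : measurable_fun setT (W i). Proof. by case: WP. Qed.

Lemma measurable_local_time (x : int) :
  measurable_fun setT (local_time W x : Omega -> \bar R).
Proof.
apply: (ge0_emeasurable_sum (h := fun i o => visits x (W i o)) (P := xpredT)).
  by move=> i o _ _; have [->|[m ->]] := @visits_natP R x (W i o).
by move=> i _; apply: measurableT_comp; [exact: measurable_visits|exact: mW].
Qed.

Variables (x : nat) (x0 : (0 < x)%N).
Let p : R := (2 * x%:R)^-1.
(** [T] k is the rate of trajectories with more than k visits to x, and [lam] j = T j - T (j + 1)
    that of trajectories with exactly j + 1. *)
Let T k : R := alpha * (x%:R ^+ 2 * p * (1 - p) ^+ k).
Let lam j : R := alpha * x%:R ^+ 2 * p ^+ 2 * (1 - p) ^+ j.
Local Notation at_most := (@visits_at_most R x%:Z).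

Let p01 : 0 < p < 1.
Proof.
have x1 : 1 <= x%:R :> R by rewrite ler1n.
rewrite invr_gt0 mulr_gt0 ?ltr0n//= invf_lt1 ?mulr_gt0 ?ltr0n//; lra.
Qed.

Let T_gt0 k : 0 < T k.
Proof.
have /andP[p0 p1] := p01.
by rewrite !mulr_gt0 ?exprn_gt0 ?subr_gt0 ?ltr0n.
Qed.

Let lam_gt0 j : 0 < lam j.
Proof.
have /andP[p0 p1] := p01.
by rewrite !mulr_gt0 ?exprn_gt0 ?subr_gt0 ?ltr0n.
Qed.

Let lamE j : lam j = T j - T j.+1.
Proof. by rewrite /lam /T [(1 - p) ^+ j.+1]exprS; ring. Qed.

Let mass_tail k : (alpha%:E * nu (~` at_most k))%E = (T k)%:E.
Proof. by rewrite (intensity_many_visits QP nuP x0) -EFinM. Qed.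

Let mass_level j : (alpha%:E * nu (@visits_level R x%:Z j))%E = (lam j)%:E.
Proof.
have mA k := measurable_mod_visits_at_most (R := R) x%:Z k.
have E : @visits_level R x%:Z j = (~` at_most j) `\` ~` at_most j.+1.
  by rewrite /visits_level !setDE setCK setIC.
have nuT := intensity_many_visits QP nuP x0.
rewrite E measureD; [|exact: measurableC|exact: measurableC|]; last first.
  by rewrite [X in (X < _)%E](nuT j) ltry.
have -> : (~` at_most j) `&` (~` at_most j.+1) = ~` at_most j.+1.
  apply/seteqP; split=> [w []//|w H]; split=> // H'; apply: H.
  by apply: le_trans H' _; rewrite lee_fin ler_nat.
rewrite [X in (_ * (X - _))%E](nuT j) [X in (_ * (_ - X))%E](nuT j.+1).
by rewrite -EFinB -EFinM lamE /T mulrBr.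
Qed.

Let count_tail k n :
  P [set o | counting [set i | (~` at_most k) (W i o)] = n%:R%:E :> \bar R] =
  (T k ^+ n / n`!%:R * expR (- T k))%:E.
Proof.
have := WP.2 1 (fun=> ~` at_most k) (fun=> n).
rewrite big_ord1 mass_tail /= poisson_prob_set1// => <- //.
- congr (P _); apply/seteqP; split=> o /= H; first by move=> _.
  exact: (H ord0).
- by move=> _; apply: measurableC; exact: measurable_mod_visits_at_most.
- by apply/trivIsetP => i j _ _; rewrite !ord1 eqxx.
- by move=> _; rewrite ltry.
Qed.

(** Excluding trajectories with more than M visits makes the local time a finite combination of the
    counts. *)
Let levels_event (M : nat) (k : 'I_M -> nat) : set Omega :=
  [set o | forall j : 'I_M, counting [set i | @visits_level R x%:Z j (W i o)] =
     (k j)%:R%:E :> \bar R] `&`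
  [set o | counting [set i | (~` at_most M) (W i o)] = 0%:R%:E :> \bar R].

Let count_levels (M : nat) (k : 'I_M -> nat) : P (levels_event k) =
  (expR (- T 0%N) * \prod_(j < M) (lam j ^+ k j / (k j)`!%:R))%:E.
Proof.
(* The levels and the tail form one family of M + 1 disjoint sets; [kk] prescribes the count 0 at
   the last index. *)
pose A (j : 'I_M.+1) : set trajectory_mod_shift :=
  if (j < M)%N then @visits_level R x%:Z j else ~` at_most M.
pose kk (j : 'I_M.+1) : nat := if insub (j : nat) is Some i then k i else 0%N.
have Aw (j : 'I_M) : A (widen_ord (leqnSn M) j) = @visits_level R x%:Z j.
  by rewrite /A /= ltn_ord.
have Am : A ord_max = ~` at_most M by rewrite /A /= ltnn.
have kw (j : 'I_M) : kk (widen_ord (leqnSn M) j) = k j by rewrite /kk /= valK.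
have km : kk ord_max = 0%N by rewrite /kk insubF//= ltnn.
have ordP (j : 'I_M.+1) : j = ord_max \/ exists i : 'I_M, j = widen_ord (leqnSn M) i.
  have := ltn_ord j; rewrite ltnS leq_eqVlt => /predU1P[jM|jM]; [left|right].
    exact: val_inj.
  by exists (Ordinal jM); exact: val_inj.
have mA j : measurable (A j).
  have [->|[i ->]] := ordP j; first by rewrite Am; apply: measurableC; exact: measurable_mod_visits_at_most.
  by rewrite Aw; exact: measurable_visits_level.
have tA : trivIset setT A.
  have lt_tail (i : 'I_M) : @visits_level R x%:Z i `&` ~` at_most M = set0.
    apply/seteqP; split=> // w [/visits_levelP vw]; apply.
    by rewrite /visits_at_most /= vw lee_fin ler_nat.
  apply/trivIsetP => i j _ _ ij.
  have [Ei|[i' Ei]] := ordP i; have [Ej|[j' Ej]] := ordP j; subst i j.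
  - by rewrite eqxx in ij.
  - by rewrite Am Aw setIC lt_tail.
  - by rewrite Am Aw lt_tail.
  - rewrite !Aw; apply/seteqP; split=> // w [/visits_levelP E1 /visits_levelP].
    rewrite E1 => /eqP; rewrite eqe eqr_nat eqSS => /eqP ij'.
    by move: ij; rewrite (val_inj ij') eqxx.
have fA j : ((alpha%:E * nu (A j))%E < +oo)%E.
  have [->|[i ->]] := ordP j; first by rewrite Am mass_tail ltry.
  by rewrite Aw mass_level ltry.
have := WP.2 M.+1 A kk mA tA fA.
rewrite big_ord_recr /= Am km mass_tail /= poisson_prob_set1// expr0 divr1 mul1r.
under eq_bigr do rewrite Aw kw mass_level /= poisson_prob_set1//.
have -> : [set o | forall j, counting [set i | A j (W i o)] = (kk j)%:R%:E :> \bar R] =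
    levels_event k.
  apply/seteqP; split=> o /=.
    move=> H; split=> [j|]; first by have := H (widen_ord (leqnSn M) j); rewrite Aw kw.
    by have := H ord_max; rewrite Am km.
  move=> [H1 H2] j; have [->|[i ->]] := ordP j; first by rewrite Am km.
  by rewrite Aw kw.
move=> ->; rewrite prodEFin -EFinM; congr (_%:E).
rewrite big_split /= -mulrA mulrC; congr (_ * _).
(* The exponents telescope to [T] 0 for every M, so the normalization does not depend on the
   truncation. *)
elim: M {k A kk Aw Am kw km ordP mA tA fA} => [|M IH]; first by rewrite big_ord0 mul1r.
rewrite big_ord_recr /= -mulrA -expRD -opprD.
by have -> : lam M + T M.+1 = T M by rewrite lamE subrK.
Qed.

Let measurable_count (B : set trajectory_mod_shift) n : measurable B ->
  measurable [set o | counting [set i | B (W i o)] = n%:R%:E :> \bar R].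
Proof.
move=> mB.
have mf : measurable_fun setT (fun o => counting [set i | B (W i o)] : \bar R).
  rewrite (_ : (fun o => _) = fun o => (\sum_(i <oo) (\1_B (W i o))%:E)%E).
    apply: (ge0_emeasurable_sum (h := fun i o => (\1_B (W i o))%:E) (P := xpredT)).
      by move=> *; rewrite lee_fin.
    move=> i _; apply/measurable_EFinP; apply: measurableT_comp => //.
  by apply/funext => o; rewrite counting_dirac.
rewrite -[X in measurable X]setTI.
exact: (mf measurableT _ (emeasurable_set1 n%:R%:E)).
Qed.

Let measurable_levels_event M (k : 'I_M -> nat) : measurable (levels_event k).
Proof.
apply: measurableI; last first.
  by apply: measurable_count; apply: measurableC; exact: measurable_mod_visits_at_most.
rewrite (_ : [set o | _] = \bigcap_(j : 'I_M) [set o |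
    counting [set i | @visits_level R x%:Z j (W i o)] = (k j)%:R%:E :> \bar R]).
  apply: fin_bigcap_measurable => [|j _]; first exact: finite_finset.
  by apply: measurable_count; exact: measurable_visits_level.
by apply/seteqP; split=> o /= H j => [_|]; exact: H.
Qed.

Let local_time_levels M o : counting [set i | (~` at_most M) (W i o)] = 0%:R%:E :> \bar R ->
  local_time W x%:Z o = (\sum_(j < M) j.+1%:R%:E *
    counting [set i | @visits_level R x%:Z j (W i o)])%E :> \bar R.
Proof.
move/counting_eq0 => H; apply: sum_visits_level => i.
by apply: contrapT => nH; have : [set i | (~` at_most M) (W i o)] i by []; rewrite H.
Qed.

Let patterns (M m : nat) : seq {ffun 'I_M -> 'I_M.+1} :=
  [seq k : {ffun 'I_M -> 'I_M.+1} <- enum {: {ffun 'I_M -> 'I_M.+1}}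
    | (\sum_(j < M) j.+1 * k j)%N == m].

Let visits_le_local_time i o : (visits x%:Z (W i o) <= local_time W x%:Z o :> \bar R)%E.
Proof.
have v0 n : (0 <= visits x%:Z (W n o) :> \bar R)%E.
  by have [->|[m ->]] := @visits_natP R x%:Z (W n o); rewrite ?lee_fin.
apply: (@le_trans _ _ (\sum_(0 <= n < i.+1) visits x%:Z (W n o))%E).
  by rewrite big_nat_recr//= leeDr// sume_ge0.
exact: nneseries_lim_ge.
Qed.

(** A local time m <= M leaves no room for a trajectory with more than M visits, nor for a level
    with more than m trajectories; finitely many patterns of counts therefore suffice. *)
Let local_time_eventE m M : (m <= M)%N ->
  [set o | local_time W x%:Z o = m%:R%:E :> \bar R] =
  \bigcup_(k in [set` patterns M m])
    levels_event (fun j : 'I_M => nat_of_ord ((k : {ffun 'I_M -> 'I_M.+1}) j)).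
Proof.
move=> mM; apply/seteqP; split=> o /=; last first.
  move=> [k /=]; rewrite mem_filter => /andP[/eqP km _] [Hk HM].
  rewrite (local_time_levels HM); under eq_bigr do rewrite Hk -EFinM -natrM.
  by rewrite sumEFin -natr_sum km.
move=> lm.
have HM : counting [set i | (~` at_most M) (W i o)] = 0%:R%:E :> \bar R.
  apply/counting_eq0/seteqP; split=> // i /=; apply.
  rewrite /visits_at_most /=; apply: (@le_trans _ _ (m%:R%:E)); last by rewrite lee_fin ler_nat.
  by rewrite -lm visits_le_local_time.
have := local_time_levels HM; rewrite lm => E.
have /choice[n nP] : forall j : 'I_M, exists n : nat, (n <= m)%N /\
    counting [set i | @visits_level R x%:Z j (W i o)] = n%:R%:E :> \bar R.
  move=> j; have : (counting [set i | @visits_level R x%:Z j (W i o)] <= m%:R%:E :> \bar R)%E.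
    rewrite E (bigD1 j)//=.
    apply: (@le_trans _ _ (j.+1%:R%:E * counting [set i | @visits_level R x%:Z j (W i o)])%E).
      by rewrite -[leLHS]mul1e lee_wpmul2r ?counting_ge0// lee_fin ler1n.
    by rewrite leeDl// sume_ge0// => l _; rewrite mule_ge0 ?counting_ge0// lee_fin.
  have [->|[l ->]] := @counting_natP _ R [set i | @visits_level R x%:Z j (W i o)].
    by rewrite leye_eq.
  by rewrite lee_fin ler_nat => lm'; exists l.
have nK j : nat_of_ord (inord (n j) : 'I_M.+1) = n j.
  by rewrite inordK// ltnS (leq_trans (nP j).1).
exists [ffun j => inord (n j)].
  rewrite /= mem_filter mem_enum andbT.
  under eq_bigr do rewrite ffunE nK.
  have {}E : m%:R%:E = (\sum_(j < M) (j.+1 * n j)%:R%:E)%E :> \bar R.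
    by rewrite E; apply: eq_bigr => j _; rewrite (nP j).2 -EFinM -natrM.
  by move/eqP: E; rewrite sumEFin -natr_sum eqe eqr_nat eq_sym.
by split=> // j /=; rewrite ffunE nK (nP j).2.
Qed.

(** M stays free so that one polynomial serves the three consecutive values in the recursion. *)
Lemma local_time_pmf m M : (m <= M)%N ->
  P [set o | local_time W x%:Z o = m%:R%:E :> \bar R] =
  (expR (- T 0%N) * (compound_poisson_poly lam M)`_m)%:E.
Proof.
move=> mM; rewrite (local_time_eventE mM).
set D := [set` _]; set F := fun k => levels_event _.
have tF : trivIset D F.
  apply/trivIsetP => k k' _ _ kk'; apply/seteqP; split=> // o [[H _] [H' _]].
  move/eqP: kk'; apply; apply/ffunP => j; apply: val_inj.
  by have := H' j; rewrite H => /eqP; rewrite eqe eqr_nat => /eqP.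
have mF k : D k -> measurable (F k) by move=> _; exact: measurable_levels_event.
rewrite (measure_fin_bigcup P (finite_seq _) tF mF) -fsbig_seq/=; last first.
  by rewrite filter_uniq// enum_uniq.
rewrite (eq_bigr (fun k : {ffun 'I_M -> 'I_M.+1} =>
    (expR (- T 0%N) * \prod_(j < M) (lam j ^+ k j / (k j)`!%:R))%:E)); last first.
  by move=> k _; exact: count_levels.
rewrite sumEFin -mulr_sumr; congr (_ * _)%:E.
by rewrite coef_compound_poisson_poly /patterns big_filter big_enum_cond.
Qed.

Lemma local_time_recursion : polya_aeppli_recursion p (alpha * x%:R ^+ 2)
  (fun m => fine (P [set o | local_time W x%:Z o = m%:R%:E :> \bar R])).
Proof.
move=> m.
have lamG j : lam j = p ^+ 2 * (alpha * x%:R ^+ 2) * (1 - p) ^+ j by rewrite /lam; ring.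
have := compound_geometric_recursion lamG (ltnSn m).
rewrite !(@local_time_pmf _ m.+1)//=; last by rewrite (leq_trans (leq_pred m)).
set e := expR _; set C := compound_poisson_poly _ _ => H.
by rewrite mulrCA H; ring.
Qed.

Let measurable_local_time_eq m :
  measurable [set o | local_time W x%:Z o = m%:R%:E :> \bar R].
Proof.
rewrite -[X in measurable X]setTI.
have mf := measurable_local_time x%:Z.
exact: (mf measurableT _ (emeasurable_set1 (m%:R%:E : \bar R))).
Qed.

(** The number of trajectories hitting x has the Poisson probabilities, which sum to 1, so it is
    almost surely finite. *)
Let finitely_many_hits : P (\bigcup_n [set o |
  counting [set i | (~` at_most 0) (W i o)] = n%:R%:E :> \bar R]) = 1%E.
Proof.
have total : (\sum_(n <oo) (poisson_pmf (T 0%N) n)%:E = 1)%E.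
  have := probability_setT (poisson_prob (T 0%N) 0%N).
  rewrite -[X in X = _]/(poisson_prob (T 0%N) 0%N setT) /poisson_prob T_gt0 => <-.
  by rewrite nneseries_esumT// => n; rewrite lee_fin poisson_pmf_ge0.
have mN n : measurable [set o |
    counting [set i | (~` at_most 0) (W i o)] = n%:R%:E :> \bar R].
  by apply: measurable_count; apply: measurableC; exact: measurable_mod_visits_at_most.
rewrite measure_semi_bigcup//; last 2 first.
- apply/trivIsetP => i j _ _ ij; apply/seteqP; split=> // o [/= -> /eqP].
  by rewrite eqe eqr_nat (negbTE ij).
- exact: bigcupT_measurable.
rewrite -total; apply: eq_eseriesr => n _.
by rewrite [LHS]count_tail /poisson_pmf T_gt0.
Qed.

Let local_time_finite_event J :
  [set o | counting [set i | (~` at_most J) (W i o)] = 0%:R%:E :> \bar R] `&`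
  (\bigcup_n [set o | counting [set i | (~` at_most 0) (W i o)] = n%:R%:E :> \bar R])
  `<=` \bigcup_m [set o | local_time W x%:Z o = m%:R%:E :> \bar R].
Proof.
move=> o [/= HJ [n _ /= Hn]].
have /choice[k kP] : forall j : 'I_J, exists k : nat,
    counting [set i | @visits_level R x%:Z j (W i o)] = k%:R%:E :> \bar R.
  move=> j; have : (counting [set i | @visits_level R x%:Z j (W i o)] <= n%:R%:E :> \bar R)%E.
    have /counting_leP H : (counting [set i | (~` at_most 0) (W i o)] <= n%:R%:E :> \bar R)%E.
      by rewrite Hn.
    apply/counting_leP => s us sA; apply: H us _ => i /sA /visits_levelP vi.
    by rewrite /visits_at_most /= vi lee_fin ler_nat.
  have [->|[l ->]] := @counting_natP _ R [set i | @visits_level R x%:Z j (W i o)].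
    by rewrite leye_eq.
  by move=> _; exists l.
exists (\sum_(j < J) j.+1 * k j)%N => //=.
rewrite (local_time_levels HJ) natr_sum -sumEFin; apply: eq_bigr => j _.
by rewrite kP natrM EFinM.
Qed.

(** The local time is finite as soon as finitely many trajectories hit x, which is almost sure, and
    none visits it more than J times. The latter has probability exp(- T J), which tends to 1 with
    J. *)
Lemma local_time_pmf_total :
  \sum_(m < M) fine (P [set o | local_time W x%:Z o = m%:R%:E :> \bar R])
    @[M --> \oo] --> (1 : R).
Proof.
have mU : measurable (\bigcup_m [set o | local_time W x%:Z o = m%:R%:E :> \bar R]).
  exact: bigcup_measurable.
have PU : P (\bigcup_m [set o | local_time W x%:Z o = m%:R%:E :> \bar R]) = 1%E.
  apply/eqP; rewrite eq_le probability_le1//=.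
  have expT J : ((expR (- T J))%:E <=
      P (\bigcup_m [set o | local_time W x%:Z o = m%:R%:E :> \bar R]))%E.
    have mJ : measurable [set o | counting [set i | (~` at_most J) (W i o)] = 0%:R%:E :> \bar R].
      by apply: measurable_count; apply: measurableC; exact: measurable_mod_visits_at_most.
    have mN : measurable (\bigcup_n [set o |
        counting [set i | (~` at_most 0) (W i o)] = n%:R%:E :> \bar R]).
      apply: bigcup_measurable => n _; apply: measurable_count; apply: measurableC.
      exact: measurable_mod_visits_at_most.
    have := count_tail J 0; rewrite expr0 divr1 mul1r => <-.
    rewrite -(probability_setI1 mJ mN finitely_many_hits).
    apply: le_measure; last exact: local_time_finite_event.
    - by rewrite inE; exact: measurableI.
    - by rewrite inE.
  have fU : P (\bigcup_m [set o | local_time W x%:Z o = m%:R%:E :> \bar R]) \is a fin_num.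
    by rewrite fin_num_measure.
  rewrite -(fineK fU) lee_fin.
  have E1 : expR (- T J) @[J --> \oo] --> (1 : R).
    have -> : 1 = expR (- (alpha * (x%:R ^+ 2 * p * 0))) :> R by rewrite !mulr0 oppr0 expR0.
    apply: continuous_cvg; first exact: continuous_expR.
    apply: cvgN; apply: cvgM; first exact: cvg_cst.
    apply: cvgM; first exact: cvg_cst.
    have /andP[p0 p1] := p01.
    by apply: (@cvg_expr _ (1 - p)); rewrite gtr0_norm ?subr_gt0//; lra.
  have L : limn (fun J => expR (- T J)) <=
      fine (P (\bigcup_m [set o | local_time W x%:Z o = m%:R%:E :> \bar R])).
    apply: limr_le; first by apply/cvg_ex; eexists; exact: E1.
    by apply: nearW => J; rewrite -lee_fin fineK//; exact: expT.
  by rewrite (cvg_lim (@Rhausdorff R) E1) in L.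
have tI : trivIset setT (fun m => [set o | local_time W x%:Z o = m%:R%:E :> \bar R]).
  apply/trivIsetP => i j _ _ ij; apply/seteqP; split=> // o [/= -> /eqP].
  by rewrite eqe eqr_nat (negbTE ij).
have H : (\sum_(0 <= m < M) P [set o | local_time W x%:Z o = m%:R%:E :> \bar R])%E
    @[M --> \oo] --> 1%E.
  rewrite -PU; apply: measure_semi_sigma_additive => //.
move/fine_cvgP : H => [_ H].
rewrite (_ : (fun M => _) = fine \o (fun M =>
  \sum_(0 <= m < M) P [set o | local_time W x%:Z o = m%:R%:E :> \bar R])%E)//.
apply/funext => M /=; rewrite big_mkord sum_fine// => m _.
by rewrite fin_num_measure.
Qed.

End local_time_law.

(** * Convergence in law of the standardized local time *)

(** Nothing is known of X outside the first M events, and the probability of that remainder is the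
    gap between the two bounds. *)
Lemma discrete_cdf_bounds {R : realType} d (Omega : measurableType d)
    (P : probability Omega R) (X : Omega -> R) (E : nat -> set Omega)
    (s : nat -> R) (t : R) (M : nat) :
  measurable_fun setT X -> (forall m, measurable (E m)) -> trivIset setT E ->
  (forall m o, E m o -> X o = s m) ->
  \sum_(m < M) fine (P (E m)) * (s m <= t)%R%:R <= fine (P [set o | X o <= t])
    <= \sum_(m < M) fine (P (E m)) * (s m <= t)%R%:R + (1 - \sum_(m < M) fine (P (E m))).
Proof.
move=> mX mE tE XE.
have mXt : measurable [set o | X o <= t].
  rewrite -[X in measurable X]setTI.
  have := mX measurableT `]-oo, t]%classic (measurable_itv _).
  by congr measurable; apply/seteqP; split=> o /=; rewrite in_itv.
pose A := \big[setU/set0]_(m < M | s m <= t) E m.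
pose U := \big[setU/set0]_(m < M) E m.
have mA : measurable A by apply: bigsetU_measurable.
have mU : measurable U by apply: bigsetU_measurable.
have tM : trivIset setT (fun m : 'I_M => E m).
  apply/trivIsetP => i j _ _ ij; move/trivIsetP : tE; apply => //.
have PA : fine (P A) = \sum_(m < M) fine (P (E m)) * (s m <= t)%R%:R.
  rewrite /A measure_bigsetU_ord// -sum_fine; last by move=> m _; rewrite fin_num_measure.
  by rewrite big_mkcond; apply: eq_bigr => m _; case: ifP; rewrite ?mulr1 ?mulr0.
have PU : fine (P U) = \sum_(m < M) fine (P (E m)).
  by rewrite /U measure_bigsetU_ord// -sum_fine// => m _; rewrite fin_num_measure.
have fP B : measurable B -> P B \is a fin_num by move=> mB; rewrite fin_num_measure.
rewrite -PA -PU; apply/andP; split.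
  rewrite fine_le ?fP//; apply: le_measure; rewrite ?inE// => o.
  rewrite /A -bigcup_seq_cond => -[m /= /andP[_ sm] Em].
  by rewrite (XE _ _ Em).
have -> : 1 - fine (P U) = fine (P (~` U)).
  by rewrite probability_setC// fineB// fP.
rewrite -fineD ?fP//; last exact: measurableC.
rewrite fine_le ?fP//; first by rewrite fin_numD !fP//; exact: measurableC.
apply: (@le_trans _ _ (P (A `|` ~` U))).
  apply: le_measure; rewrite ?inE//; first by apply: measurableU => //; exact: measurableC.
  move=> o /= Xt; have [Uo|nUo] := pselect (U o); last by right.
  left; move: Uo; rewrite /U /A -!bigcup_seq_cond => -[m /= mM Em].
  by exists m => //=; rewrite mem_index_enum -(XE _ _ Em).
by apply: measureU2 => //; exact: measurableC.
Qed.

Unset Implicit Arguments.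

(* The local time is almost surely finite, whence [fine]. *)
Theorem theorem1p2 (R : realType) (d : measure_display)
    (Omega : measurableType d) (P : probability Omega R) (alpha : R)
    (W : nat -> Omega -> trajectory_mod_shift) :
  0 < alpha ->
  random_interlacements P alpha W ->
  cvg_in_law P
    (fun (x : nat) (o : Omega) =>
      (fine (local_time W x%:Z o : \bar R) - alpha * x%:R ^+ 2)
        / (x%:R * Num.sqrt (alpha * (4 * x%:R - 1))))
    (normal_prob (0 : R) 1).
Proof.
move=> alpha0 [Q [nu [QP nuP WP]]].
pose X (x : nat) (o : Omega) : R :=
  (fine (local_time W x%:Z o : \bar R) - alpha * x%:R ^+ 2)
    / (x%:R * Num.sqrt (alpha * (4 * x%:R - 1))).
have mL (x : int) : measurable_fun setT (local_time W x : Omega -> \bar R).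
  exact: measurable_local_time WP x.
have mX n : measurable_fun setT (X n).
  apply: measurable_funM; last exact: measurable_cst.
  apply: measurable_funB; last exact: measurable_cst.
  by apply: measurableT_comp; [exact: fine_measurable|exact: mL].
split=> [n|t _]; first exact: mX.
pose E (x m : nat) : set Omega := [set o | local_time W x%:Z o = m%:R%:E :> \bar R].
have mE x m : measurable (E x m).
  rewrite -[X in measurable X]setTI.
  exact: (mL x%:Z measurableT _ (emeasurable_set1 (m%:R%:E : \bar R))).
have tE x : trivIset setT (E x).
  apply/trivIsetP => i j _ _ ij; apply/seteqP; split=> // o [Ei Ej].
  have /eqP : i%:R%:E = j%:R%:E :> \bar R by rewrite -Ei -Ej.
  by rewrite eqe eqr_nat (negbTE ij).
have clt : fine (P [set o | X n o <= t]) @[n --> \oo] --> normal_cdf t.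
  apply: (polya_aeppli_clt alpha0 (q := fun x m => fine (P (E x m)))).
  - by move=> x m; rewrite fine_ge0.
  - by move=> x x0; exact: (local_time_pmf_total alpha0 QP nuP WP x0).
  - by move=> x x0; exact: (local_time_recursion alpha0 QP nuP WP x0).
  (* An infinite local time, which [fine] sends to 0, lies outside all the [E] x m and so falls in
     the gap between the bounds. *)
  - move=> x x0 M; pose s (m : nat) : R := (m%:R - alpha * x%:R ^+ 2)
      / (x%:R * Num.sqrt (alpha * (4 * x%:R - 1))).
    have XE m o : E x m o -> X x o = s m by move=> Em; rewrite /X Em.
    exact: (discrete_cdf_bounds P t M (mX x) (mE x) (tE x) XE).
have H : P [set o | X n o <= t] @[n --> \oo] --> (normal_cdf t)%:E.
  have -> : (fun n => P [set o | X n o <= t]) = EFin \o (fun n => fine (P [set o | X n o <= t])).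
    apply/funext => n /=; rewrite fineK// fin_num_measure//.
    rewrite -[X in measurable X]setTI.
    have := mX n measurableT `]-oo, t]%classic (measurable_itv _).
    by congr measurable; apply/seteqP; split=> o /=; rewrite in_itv.
  by apply: cvg_EFin; first exact: nearW.
by move: H; rewrite normal_cdfE.
Qed.
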